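(* Let $T>0$, let $H$ be the Heaviside function ($H(x)=0$ for $x<0$, $H(x)=1$ for $x\ge0$), and let $g_0,g_1\in C_c^\infty(\mathbb{R})$ satisfy the compatibility condition $g_1(t)+g_0'(t)-g_1(0)=0$ for $t\geq 0$. Consider the Cauchy problem $$\partial_t^2u(t,x)-\partial_x\big(H(x)\partial_xu(t,x)\big)=0,\quad t\in[0,T],\ x\in\mathbb{R},\qquad u(0,x)=g_0(x),\quad \partial_tu(0,x)=g_1(x).$$ Then every very weak solution $(u_\varepsilon)_\varepsilon$ of this Cauchy problem converges, as $\varepsilon\to0$, in $C([0,T],L^2(\mathbb{R}))$ to the piecewise distributional solution $\bar u$.
   Context: Very weak solution: let $\varphi\in C_c^\infty(\mathbb{R})$ be a mollifier ($\varphi\ge0$, $\int\varphi=1$), let $\omega(\varepsilon)$ be a positive scale with $\omega(\varepsilon)\to0$ as $\varepsilon\to0$, put $\varphi_{\omega(\varepsilon)}(x)=\omega(\varepsilon)^{-1}\varphi(x/\omega(\varepsilon))$ and $H_\varepsilon=H*\varphi_{\omega(\varepsilon)}$. A very weak solution is a net $(u_\varepsilon)_{\varepsilon\in(0,1]}$ of solutions of $$\partial_t^2u_\varepsilon-\partial_x(H_\varepsilon(x)\partial_xu_\varepsilon)=0,\quad t\in[0,T],\ x\in\mathbb{R},\qquad u_\varepsilon(0,x)=g_0(x),\quad\partial_tu_\varepsilon(0,x)=g_1(x),$$ which is $L^2$-moderate: there exist $N\in\mathbb{N}_0$, $c>0$ with $\|u_\varepsilon(t,\cdot)\|_{L^2(\mathbb{R})}\le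 c\,\varepsilon^{-N}$ for all $t\in[0,T]$, $\varepsilon\in(0,1]$. Piecewise distributional solution $\bar u$: the function obtained by solving the equation separately on $x<0$ and on $x>0$ and combining the two under the transmission conditions that $\bar u$, $\partial_t\bar u$ and $H\partial_x\bar u$ are continuous across $x=0$. Explicitly, for $t\in[0,T]$, $$\bar u(t,x)=\begin{cases} g_0(x)+t\,g_1(x), & x<0,\\ \tfrac12\big(g_0(x+t)-g_0(t-x)\big)+\tfrac12\int_{t-x}^{x+t}g_1(s)\,ds+g_0(0)+(t-x)g_1(0), & 0\le x<t,\\ \tfrac12\big(g_0(x+t)+g_0(x-t)\big)+\tfrac12\int_{x-t}^{x+t}g_1(s)\,ds, & x\ge t.\end{cases}$$ *)

(* Defs.v *)
From HB Require Import structures.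
From mathcomp Require Import all_boot all_order all_algebra.
From mathcomp Require Import all_classical all_reals all_analysis.
Set Implicit Arguments.
Unset Strict Implicit.
Unset Printing Implicit Defensive.
Import Order.TTheory GRing.Theory Num.Theory.
Import numFieldNormedType.Exports.
Local Open Scope classical_set_scope.
Local Open Scope ring_scope.

Notation leb R := (@lebesgue_measure R).

Definition smooth (R : realType) (f : R -> R) : Prop :=
  forall (n : nat) (x : R), derivable (derive1n n f) x 1.

Definition test_function (R : realType) (f : R -> R) : Prop :=
  smooth f /\ compact (closure [set x | f x != 0]).

Definition mollifier (R : realType) (phi : R -> R) : Prop :=
  [/\ test_function phi, forall x : R, 0 <= phi x & \int[leb R]_x phi x = 1].

(* Only the values of omega on ]0, 1] matter. *)
Definition positive_scale (R : realType) (omega : R -> R) : Prop :=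
  (forall eps : R, 0 < eps <= 1 -> 0 < omega eps) /\ omega @ 0^'+ --> 0.

Definition heaviside (R : realType) (x : R) : R := if 0 <= x then 1 else 0.

Definition conv (R : realType) (f g : R -> R) (x : R) : R :=
  \int[leb R]_y (f y * g (x - y)).

Definition rescale (R : realType) (phi : R -> R) (w x : R) : R :=
  w^-1 * phi (x / w).

Definition regularised (R : realType) (H phi omega : R -> R) (eps : R) : R -> R :=
  conv H (rescale phi (omega eps)).

(* Functions on [0, T] x R are functions u : R -> R -> R of (t, x), of which   *)
(* only the values with t in [0, T] matter.  Derivatives in t are limits of    *)
(* difference quotients taken inside [0, T], hence one-sided at 0 and T.       *)
Definition time_quotient (R : realType) (T : R) (u : R -> R -> R) (t x : R) :=
  (fun s : R => (s - t)^-1 * (u s x - u t x)) @ within `[0, T] t^'.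

Definition Dt (R : realType) (T : R) (u : R -> R -> R) (t x : R) : R :=
  lim (time_quotient T u t x).

Definition Dx (R : realType) (u : R -> R -> R) (t x : R) : R := derive1 (u t) x.

Definition strip (R : realType) (T : R) : set (R * R) :=
  [set p | 0 <= p.1 <= T].

Fixpoint Ck_strip (R : realType) (T : R) (k : nat) (u : R -> R -> R) : Prop :=
  {within strip T, continuous (fun p : R * R => u p.1 p.2)} /\
  (if k is k'.+1 then
     [/\ forall t x : R, 0 <= t <= T ->
           cvg (time_quotient T u t x) /\ derivable (u t) x 1,
         Ck_strip T k' (Dt T u) & Ck_strip T k' (Dx u)]
   else True).

(* Classical solution of u_tt - (a(x) u_x)_x = 0 on [0, T] x R with data g0, g1. *)
Definition wave_solution (R : realType) (T : R) (a g0 g1 : R -> R)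
    (u : R -> R -> R) : Prop :=
  [/\ Ck_strip T 2 u,
      forall t x : R, 0 <= t <= T ->
        derivable (fun y : R => a y * Dx u t y) x 1 /\
        Dt T (Dt T u) t x - derive1 (fun y : R => a y * Dx u t y) x = 0,
      forall x : R, u 0 x = g0 x &
      forall x : R, Dt T u 0 x = g1 x].

Definition L2norm (R : realType) (f : R -> R) : \bar R :=
  Lnorm (leb R) 2%:E (EFin \o f).

Definition L2_moderate (R : realType) (T : R) (u : R -> R -> R -> R) : Prop :=
  exists (N : nat) (c : R), 0 < c /\
    forall eps t : R, 0 < eps <= 1 -> 0 <= t <= T ->
      u eps t \in Lfun (leb R) 2%:E /\
      (L2norm (u eps t) <= (c * eps ^- N)%:E)%E.

Definition very_weak_solution (R : realType) (T : R) (H phi omega g0 g1 : R -> R)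
    (u : R -> R -> R -> R) : Prop :=
  (forall eps : R, 0 < eps <= 1 ->
     wave_solution T (regularised H phi omega eps) g0 g1 (u eps)) /\
  L2_moderate T u.

Definition piecewise_solution (R : realType) (g0 g1 : R -> R) (t x : R) : R :=
  if x < 0 then g0 x + t * g1 x
  else if x < t then
    2^-1 * (g0 (x + t) - g0 (t - x))
    + 2^-1 * (\int[leb R]_(s in `[t - x, x + t]) g1 s)
    + g0 0 + (t - x) * g1 0
  else
    2^-1 * (g0 (x + t) + g0 (x - t))
    + 2^-1 * (\int[leb R]_(s in `[x - t, x + t]) g1 s).

Definition in_CL2 (R : realType) (T : R) (v : R -> R -> R) : Prop :=
  forall t : R, 0 <= t <= T ->
    v t \in Lfun (leb R) 2%:E /\
    (fun s : R => L2norm (v s \- v t)) @ within `[0, T] (nbhs t) --> 0%E.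

Definition CL2_dist (R : realType) (T : R) (v w : R -> R -> R) : \bar R :=
  ereal_sup [set L2norm (v t \- w t) | t in `[0, T]].

Definition cvg_CL2 (R : realType) (T : R) (u : R -> R -> R -> R)
    (v : R -> R -> R) : Prop :=
  [/\ forall eps : R, 0 < eps <= 1 -> in_CL2 T (u eps),
      in_CL2 T v &
      (fun eps : R => CL2_dist T (u eps) v) @ 0^'+ --> 0%E].

(* Main.v *)
(* The compatibility condition and compactness of the supports force g1(0) = 0
   and g1 = -g0' on [0, oo), so for x >= 0 the limit is the right-moving wave
   g0(max(x - t, 0)).  The regularised coefficient is 0 for x <= -a and 1 for
   x >= a, with a = K omega(eps).  For x < -a the solution u is g0 + t g1.  For
   x >= a the sum u_t + u_x is constant along x + t = const and vanishes
   initially, so u is constant along x - t = const: there u is determined by g0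
   and by its trace at x = a, which radiates without reflection.  The energy of
   the layer [-a, a] is O(a) initially, and its flux is 0 at -a and -u_t^2 at a;
   hence u(t, a) - g0(a) = O(sqrt a) and the L^2 norm of u - g0 on the layer is
   O(sqrt a).  Therefore the L^2 distance to the limit is O(sqrt a), uniformly
   in t. *)

Require Import Defs.
From HB Require Import structures.
From mathcomp Require Import all_boot all_order all_algebra.
From mathcomp Require Import all_classical all_reals all_analysis.
From mathcomp Require Import measurable_realfun ring lra.
Set Implicit Arguments.
Unset Strict Implicit.
Unset Printing Implicit Defensive.
Import Order.TTheory GRing.Theory Num.Theory.
Import numFieldNormedType.Exports.
Local Open Scope classical_set_scope.
Local Open Scope ring_scope.

(** * Functions on a strip *)

(** Inside the layer the energy controls [H u_x^2], hence no [u_x] where [H] degenerates. All layer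
    estimates therefore go through [u_t] alone and compare [u] with its own initial value. Both are
    obtained from a monotone quantity instead of Cauchy-Schwarz in time: for the trace, the energy
    plus [lam u(t, a) - lam^2 t / 8], with [lam = sqrt a] and [lam = - sqrt a] at the end; for the
    displacement, a weighted integral of [(u - g0)^2]. Only first derivatives in time of such
    quantities are needed.

    The time derivatives of a solution are one-sided at [0] and [T]. Every argument in time thus
    uses derivatives on the open interval and continuity on the closed one.

    Equality of the mixed derivatives of [u] is not part of the definition of a solution. Both the
    transport of [u_t + u_x] and the energy identity rest on it, so it is proved first. *)

Definition strip_continuous (R : realType) (T : R) (f : R -> R -> R) : Prop :=
  {within strip T, continuous (fun p : R * R => f p.1 p.2)}.

(** Clamping the time extends a function continuous on the strip to one continuous on the whole
    plane, so that statements about two-sided neighbourhoods apply also at times [0] and [T]. *)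
Definition clamp (R : realType) (T t : R) : R := Num.max 0 (Num.min t T).

Lemma clamp_itv (R : realType) (T t : R) : 0 <= T -> 0 <= clamp T t <= T.
Proof.
by move=> T0; rewrite /clamp le_max lexx/= ge_max T0 ge_min lexx orbT.
Qed.

Lemma clamp_id (R : realType) (T t : R) : 0 <= t <= T -> clamp T t = t.
Proof. by move=> /andP[t0 tT]; rewrite /clamp (min_idPl tT) (max_idPr t0). Qed.

Lemma clamp_continuous (R : realType) (T : R) : continuous (@clamp R T).
Proof.
move=> t; apply: (@continuous_max R R (fun=> 0) (fun t => Num.min t T)).
  exact: cvg_cst.
apply: (@continuous_min R R id (fun=> T)); first exact: cvg_id.
exact: cvg_cst.
Qed.

Lemma strip_clamp (R : realType) (T : R) (f : R -> R -> R) : 0 <= T ->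
  strip_continuous T f ->
  continuous (fun p : R * R => f (clamp T p.1) p.2).
Proof.
move=> T0 /subspace_continuousP cf p.
have sp q : strip T (clamp T q.1, q.2) by exact: clamp_itv.
apply: (@cvg_comp _ _ _ (fun q : R * R => (clamp T q.1, q.2))
  (fun q : R * R => f q.1 q.2) (nbhs p) (within (strip T) (nbhs (clamp T p.1,
    p.2)))); last exact: (cf _ (sp p)).
have ch : (fun q : R * R => (clamp T q.1, q.2)) @ nbhs p -->
    nbhs (clamp T p.1, p.2).
  have c2 : q.2 @[q --> p] --> p.2 by case: (p) => a b; exact: cvg_snd.
  have c1 : clamp T q.1 @[q --> p] --> clamp T p.1.
    apply: (@cvg_comp _ _ _ (@fst R R) (clamp T)); last exact: clamp_continuous.
    by case: (p) => a b; exact: cvg_fst.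
  exact: (cvg_pair c1 c2).
move=> B /ch; apply: (@filterS _ (nbhs p)) => q h; exact: (h (sp q)).
Qed.

(** Horizontal slices, vertical lines and characteristics are all instances. The time [c s] has to
    stay in [[0, T]] only for [s] in [A]. *)
Lemma strip_continuous_path (R : realType) (T : R) (f : R -> R -> R)
    (c d : R -> R) (A : set R) : 0 <= T -> strip_continuous T f ->
  continuous c -> continuous d -> (forall s, A s -> 0 <= c s <= T) ->
  {within A, continuous (fun s => f (c s) (d s))}.
Proof.
move=> T0 cf cc cd cT.
apply: (@subspace_eq_continuous _ _ _ (fun s => f (clamp T (c s)) (d s))).
  by move=> s /set_mem As; rewrite /from_subspace clamp_id//; exact: cT.
apply: continuous_subspaceT => s.
apply: (@continuous_comp _ _ _ (fun s => (c s, d s))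
  (fun q : R * R => f (clamp T q.1) q.2)).
  exact: (cvg_pair (cc s) (cd s)).
exact: strip_clamp.
Qed.

Lemma strip_continuous_bounded (R : realType) (T : R) (f : R -> R -> R)
    (a b : R) : 0 <= T -> strip_continuous T f ->
  exists C : R, forall t x : R, 0 <= t <= T -> a <= x <= b -> `|f t x| <= C.
Proof.
move=> T0 cf.
pose g (p : R * R) := f (clamp T p.1) p.2.
have : compact (g @` (`[0, T] `*` `[a, b])).
  apply: continuous_compact; last by apply: compact_setX;
    exact: segment_compact.
  by apply: continuous_subspaceT; exact: strip_clamp.
move=> /compact_bounded [M [Mr /(_ (M + 1))]].
rewrite ltrDl ltr01 => /(_ isT) gM; exists (M + 1) => t x tT xab.
have := gM (g (t, x)); rewrite /g/= clamp_id//; apply.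
by exists (t, x) => //=; rewrite ?clamp_id//; split => /=; rewrite in_itv.
Qed.

Lemma strip_continuous_slice (R : realType) (T : R) (f : R -> R -> R) (t : R) :
  strip_continuous T f -> 0 <= t <= T -> continuous (f t).
Proof.
move=> cf tT; have T0 : 0 <= T by move/andP: tT => [/le_trans]; apply.
apply/continuous_subspace_setT.
exact: (@strip_continuous_path _ T f (fun=> t) id setT T0 cf (fun=> cvg_cst _)
  (fun=> cvg_id) (fun _ _ => tT)).
Qed.

Lemma strip_continuous_time (R : realType) (T : R) (f : R -> R -> R)
    (A : set R) (x : R) : 0 <= T ->
  strip_continuous T f -> (forall s, A s -> 0 <= s <= T) ->
  {within A, continuous (f ^~ x)}.
Proof.
move=> T0 cf AT.
exact: (strip_continuous_path (c := id) (d := fun=> x) T0 cf (fun=> cvg_id)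
  (fun=> cvg_cst _) AT).
Qed.

(** * Integrals over a segment depending on time *)

Lemma continuous_integrable_itv (R : realType) (f : R -> R) (a b : R) :
  continuous f -> (leb R).-integrable `[a, b] (EFin \o f).
Proof.
move=> cf; apply: continuous_compact_integrable; first exact: segment_compact.
exact: continuous_subspaceT.
Qed.

Lemma integrable_cst_itv (R : realType) (a b c : R) :
  (leb R).-integrable `[a, b] (EFin \o fun=> c).
Proof. by apply: continuous_integrable_itv => x; exact: cvg_cst. Qed.

Lemma strip_integral_continuous (R : realType) (T a b : R) (f : R -> R -> R) :
  0 <= T -> strip_continuous T f ->
  {within `[0, T], continuous (fun s => \int[leb R]_(x in `[a, b]) f s x)}.
Proof.
move=> T0 cf; have [C hC] := strip_continuous_bounded a b T0 cf.
apply: (@subspace_eq_continuous _ _ _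
    (fun s => \int[leb R]_(x in `[a, b]) f (clamp T s) x)).
  move=> s; rewrite inE/= => sT; by rewrite /from_subspace clamp_id.
apply: continuous_subspaceT => t.
(* An open interval around [t] is available even at [t = 0] and [t = T], because the clamped
   integrand is continuous at all times. *)
have tI : t \in (`]t - 1, t + 1[%classic : set R).
  by apply/mem_set; rewrite /= in_itv/= ltrBlDr !ltrDl !ltr01.
apply: (@continuity_under_integral R _ _ (leb R) (fun s x => f (clamp T s) x)
  `[a, b] _ (t - 1) (t + 1) _ _ (fun=> C)) => //.
- move=> s _; apply: continuous_integrable_itv.
  by apply: strip_continuous_slice cf _; exact: clamp_itv.
- apply: aeW => x _ s _.
  apply: (@continuous_comp _ _ _ (fun s => (s, x))
    (fun q : R * R => f (clamp T q.1) q.2)); last exact: strip_clamp.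
  by apply: (cvg_pair (G := nbhs s) (H := nbhs x));
    [exact: cvg_id|exact: cvg_cst].
- exact: integrable_cst_itv.
- move=> s _; apply: aeW => x; rewrite /= in_itv/= => xab.
  by apply: hC => //; exact: clamp_itv.
Qed.

Lemma strip_derive_integral (R : realType) (T a b : R) (f f' : R -> R -> R)
    (t : R) : strip_continuous T f -> strip_continuous T f' -> 0 < t < T ->
  (forall s x, 0 < s < T -> a <= x <= b -> is_derive s 1 (f ^~ x) (f' s x)) ->
  is_derive t (1 : R) (fun s => \int[leb R]_(x in `[a, b]) f s x)
    (\int[leb R]_(x in `[a, b]) f' t x).
Proof.
move=> cf cf' tT df.
have T0 : 0 <= T by move/andP : tT => [t0 tT]; rewrite ltW// (lt_trans t0).
have [C hC] := strip_continuous_bounded a b T0 cf'.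
have fE s x : `]0, T[%classic s -> `[a, b]%classic x -> partial1of2 f s x = f'
  s x.
  move=> /= ; rewrite !in_itv/= => sT xab; rewrite partial1of2E.
  by have := df _ _ sT xab => dd; rewrite derive_val.
have It : `]0, T[%classic t by rewrite /= in_itv.
(* The dominating constant must be nonnegative, which is not known of [C] when the segment is empty;
   hence its absolute value. *)
have ub s x : `]0, T[%classic s -> `[a, b]%classic x -> `|partial1of2 f s x| <=
  `|C|.
  move=> sT xab; rewrite fE// (le_trans _ (ler_norm _))//; apply: hC.
    by move: sT; rewrite /= in_itv/= => /andP[s0 sT]; rewrite !ltW.
  by move: xab; rewrite /= in_itv.
have int_f s : `]0, T[%classic s -> (leb R).-integrable `[a, b] (EFin \o f s).
  rewrite /= in_itv/= => /andP[s0 sT]; apply: continuous_integrable_itv.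
  by apply: strip_continuous_slice cf _; rewrite !ltW.
have df1 s x : `]0, T[%classic s -> `[a, b]%classic x -> derivable (f ^~ x) s 1.
  by rewrite /= !in_itv/= => sT xab; have [] := df s x sT xab.
have mI : measurable (`[a, b]%classic : set R) by [].
have G0 (y : R) : 0 <= (fun=> `|C|) y by [].
apply: DeriveDef.
  exact: (@derivable_under_integral R _ _ (leb R) f _ mI t 0 T It int_f df1
    (fun=> `|C|) G0 (integrable_cst_itv _ _ _) ub).
rewrite -derive1E (@differentiation_under_integral R _ _ (leb R) f _ mI t 0 T
  It int_f df1 (fun=> `|C|) G0 (integrable_cst_itv _ _ _) ub).
apply: eq_Rintegral => x /set_mem xab; exact: fE.
Qed.

(** * Derivatives in time, in space and along lines *)

Lemma is_derive_cvg (R : realType) (f : R -> R) (t l : R) :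
  h^-1 * (f (h + t) - f t) @[h --> 0^'] --> l -> is_derive t (1 : R) f l.
Proof.
move=> fl.
have E : (fun h : R => h^-1 *: (f (h *: (1 : R) + t) - f t)) =
    (fun h => h^-1 * (f (h + t) - f t)).
  by apply/funext => h; rewrite /GRing.scale /= mulr1.
apply: DeriveDef; first by rewrite /derivable E; apply/cvg_ex; exists l.
by rewrite /derive E; exact: cvg_lim.
Qed.

Lemma cvg_is_derive (R : realType) (f : R -> R) (t l : R) :
  is_derive t (1 : R) f l -> h^-1 * (f (h + t) - f t) @[h --> 0^'] --> l.
Proof.
move=> [df <-].
have E : (fun h : R => h^-1 *: (f (h *: (1 : R) + t) - f t)) =
    (fun h => h^-1 * (f (h + t) - f t)).
  by apply/funext => h; rewrite /GRing.scale /= mulr1.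
by move: df; rewrite /derivable /derive E.
Qed.

(** At an interior time [h + t] lies in [[0, T]] for all small [h], so restricting the quotient to
    [[0, T]] does not change the limit. *)
Lemma Dt_is_derive (R : realType) (T : R) (u : R -> R -> R) (t x : R) :
  0 < t < T -> cvg (time_quotient T u t x) ->
  is_derive t (1 : R) (u ^~ x) (Dt T u t x).
Proof.
move=> /andP[t0 tT] ct; apply: is_derive_cvg.
have : time_quotient T u t x --> Dt T u t x by exact: ct.
move=> + P nP => /(_ P nP); rewrite /time_quotient /=.
have ct0 : (h + t) @[h --> (0 : R)] --> t.
  rewrite -[X in _ --> X]add0r.
  by apply: cvgD; [exact: cvg_id|exact: cvg_cst].
rewrite /within /dnbhs /fmap /= => H.
change (nbhs (0 : R) (fun h : R => h != 0 -> P (h^-1 * (u (h + t) x - u t x)))).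
have n1 : \forall h \near (0 : R), h + t < T := ct0 _ (lt_nbhsl tT).
have n2 : \forall h \near (0 : R), 0 < h + t := ct0 _ (lt_nbhsr t0).
have n3 : \forall h \near (0 : R), h + t != t -> h + t \in `[0, T] ->
  P ((h + t - t)^-1 * (u (h + t) x - u t x)) := ct0 _ H.
apply: filterS3 n1 n2 n3 => h hT h0 hP hn0.
rewrite -[X in X^-1](addrK t); apply: hP.
  by rewrite -subr_eq0 addrK.
by rewrite in_itv/= !ltW.
Qed.

(** The intermediate point is located by its distance to [y], which covers both orders of the
    endpoints and increments of either sign. *)
Lemma MVT_between (R : realType) (f df : R -> R) (y z : R) :
  (forall x, is_derive x (1 : R) f (df x)) ->
  exists2 c, `|c - y| <= `|z - y| & f z - f y = df c * (z - y).
Proof.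
move=> fd.
have fc : continuous f.
  by move=> x; apply: differentiable_continuous; apply/derivable1_diffP;
    have [] := fd x.
have [yz|/ltW zy] := leP y z.
- have [c /[!in_itv]/= /andP[yc cz] E] := MVT_segment yz (fun x _ =>
    fd x) (continuous_subspaceT fc).
  by exists c => //; rewrite !ger0_norm ?subr_ge0// lerB.
- have [c /[!in_itv]/= /andP[zc cy] E] := MVT_segment zy (fun x _ =>
    fd x) (continuous_subspaceT fc).
  exists c; first by rewrite !ler0_norm ?subr_le0// lerN2 lerB.
  by rewrite -opprB E -mulrN opprB.
Qed.

Lemma strip_continuous_near (R : realType) (T : R) (f : R -> R -> R)
    (s y e : R) : strip_continuous T f -> 0 <= s <= T -> 0 < e ->
  exists2 d : R, 0 < d & forall s' y', 0 <= s' <= T ->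
    `|s' - s| < d -> `|y' - y| < d -> `|f s' y' - f s y| < e.
Proof.
move=> cf sT e0; have T0 : 0 <= T by move/andP: sT => [/le_trans]; apply.
move/cvgrPdist_lt : (@strip_clamp R T f T0 cf (s, y)) => /(_ _ e0).
rewrite near_simpl => -[[A B]] /= [/nbhs_ballP[d1 d10 dA] /nbhs_ballP[d2 d20
  dB]] AB.
exists (Num.min d1 d2); first by rewrite lt_min d10.
move=> s' y' s'T; rewrite !lt_min => /andP[sd _] /andP[_ yd].
have := AB (s', y') => /=; rewrite !clamp_id// distrC; apply; split => /=.
  by apply: dA; rewrite /ball/= distrC.
by apply: dB; rewrite /ball/= distrC.
Qed.

(** Chain rule from partial derivatives: the increment is split into a time increment at the fixed
    point and a space increment at the shifted time. The second is handled by the mean value theorem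
    and the joint continuity of [fx]. *)
Lemma strip_derive_line (R : realType) (T : R) (f ft fx : R -> R -> R)
    (k c s : R) : 0 < s < T -> strip_continuous T fx ->
  is_derive s (1 : R) (f ^~ (c + k * s)) (ft s (c + k * s)) ->
  (forall r x : R, 0 < r < T -> is_derive x (1 : R) (f r) (fx r x)) ->
  is_derive s (1 : R) (fun r => f r (c + k * r))
    (ft s (c + k * s) + k * fx s (c + k * s)).
Proof.
move=> sT cfx /cvg_is_derive dt dx; apply: is_derive_cvg.
set y := c + k * s.
have -> : (fun h => h^-1 * (f (h + s) (c + k * (h + s)) - f s y)) =
    (fun h => h^-1 * (f (h + s) y - f s y) +
              h^-1 * (f (h + s) (y + k * h) - f (h + s) y)).
  apply/funext => h; rewrite /y (_ : c + k * (h + s) = c + k * s + k * h).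
    by rewrite -mulrDr addrC; congr (_ * _); ring.
  by ring.
apply: cvgD; first exact: dt.
apply/cvgrPdist_lt => e e0.
have [s0 sT'] := andP sT.
(* The [+ 1] keeps the denominator positive when [k = 0]. *)
have e1 : 0 < e / (`|k| + 1) by rewrite divr_gt0// ltr_wpDl.
have sTc : 0 <= s <= T by rewrite !ltW.
have [d d0 hd] := strip_continuous_near y cfx sTc e1.
have ct0 : (h + s) @[h --> (0 : R)] --> s.
  rewrite -[X in _ --> X]add0r.
  by apply: cvgD; [exact: cvg_id|exact: cvg_cst].
have n0 : \forall h \near (0 : R), 0 < h + s := ct0 _ (lt_nbhsr s0).
have nT : \forall h \near (0 : R), h + s < T := ct0 _ (lt_nbhsl sT').
have nd : \forall h \near (0 : R), `|h| < d / (`|k| + 1).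
  by apply: nbhs0_lt; rewrite divr_gt0// ltr_wpDl.
change (nbhs (0 : R) (fun h : R => h != 0 ->
  `|k * fx s y - h^-1 * (f (h + s) (y + k * h) - f (h + s) y)| < e)).
apply: filterS3 n0 nT nd => h h0 hT hd' hn0.
have hsT : 0 < h + s < T by rewrite h0 hT.
have [z zy ->] := MVT_between y (y + k * h) (fun x => dx _ x hsT).
rewrite (_ : h^-1 * _ = k * fx (h + s) z); last by field.
rewrite -mulrBr normrM.
have k1 : 0 < `|k| + 1 by rewrite ltr_wpDl.
have hd1 : `|h| * (`|k| + 1) < d by rewrite -ltr_pdivlMr.
have : `|fx (h + s) z - fx s y| < e / (`|k| + 1).
  apply: hd => //.
  - by rewrite !ltW.
  - by rewrite addrK (le_lt_trans _ hd1)// ler_peMr// lerDr.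
  - apply: (le_lt_trans zy); rewrite [y + _]addrC addrK normrM mulrC.
    by apply: le_lt_trans hd1; rewrite ler_wpM2l// lerDl.
rewrite distrC ltr_pdivlMr// mulrC; apply: le_lt_trans.
by rewrite ler_wpM2r// lerDl.
Qed.

Lemma is_derive_continuous (R : realType) (f df : R -> R) :
  (forall x, is_derive x (1 : R) f (df x)) -> continuous f.
Proof.
move=> fd x; apply: differentiable_continuous; apply/derivable1_diffP.
by have [] := fd x.
Qed.

Lemma Rintegral_FTC2 (R : realType) (f F : R -> R) (a b : R) : a <= b ->
  continuous f -> (forall x, is_derive x (1 : R) F (f x)) ->
  \int[leb R]_(x in `[a, b]) f x = F b - F a.
Proof.
rewrite le_eqVlt => /predU1P[<-|ab] cf dF.
  by rewrite set_itv1 Rintegral_set1 subrr.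
have cF := is_derive_continuous dF.
rewrite /Rintegral (@continuous_FTC2 _ f F a b ab)//.
- exact: continuous_subspaceT.
- split.
  + by move=> x _; have [] := dF x.
  + exact: cvg_at_right_filter (cF a).
  + exact: cvg_at_left_filter (cF b).
- by move=> x _; rewrite derive1E; have := dF x => dFx; rewrite derive_val.
Qed.

Lemma near_itvoo (R : realType) (a b x : R) : a < x < b ->
  \forall y \near x, a < y < b.
Proof.
move=> /andP[ax xb]; near=> y; apply/andP; split; near: y.
- exact: lt_nbhsr.
- exact: lt_nbhsl.
Unshelve. all: by end_near. Qed.

Lemma is_derive_uniq (R : realType) (f : R -> R) (x l m : R) :
  is_derive x (1 : R) f l -> is_derive x (1 : R) f m -> l = m.
Proof. by move=> [_ <-] [_ <-]. Qed.

(** Symmetry of mixed derivatives: write [u t y - u t (x - 1)] as the integral of [ux],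
    differentiate in time under the integral, then in [y] by the fundamental theorem. The base point
    [x - 1] only has to lie to the left of [x]. *)
Lemma strip_derive_comm (R : realType) (T : R) (u ut ux utx : R -> R -> R)
    (t x l : R) : 0 < t < T ->
  strip_continuous T ux -> strip_continuous T utx ->
  (forall s y : R, 0 < s < T -> is_derive s (1 : R) (u ^~ y) (ut s y)) ->
  (forall s y : R, 0 < s < T -> is_derive y (1 : R) (u s) (ux s y)) ->
  (forall s y : R, 0 < s < T -> is_derive s (1 : R) (ux ^~ y) (utx s y)) ->
  is_derive x (1 : R) (ut t) l -> l = utx t x.
Proof.
move=> tT cux cutx dt dx dtx dl.
have sTc s : 0 < s < T -> 0 <= s <= T by move=> /andP[s0 sT]; rewrite !ltW.
have utE y : x - 1 < y < x + 1 ->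
    ut t y = \int[leb R]_(z in `[x - 1, y]) utx t z + ut t (x - 1).
  move=> /andP[xy yx]; apply/eqP; rewrite -subr_eq; apply/eqP.
  apply: (@is_derive_uniq _ (fun s => u s y - u s (x - 1)) t).
    by apply: is_deriveB; exact: dt.
  apply: near_eq_is_derive; last first.
    apply: (@strip_derive_integral _ T (x - 1) y ux utx t) => // s z sT _.
    exact: dtx.
  apply: filterS (near_itvoo tT) => s sT; apply: Rintegral_FTC2;
    first exact: ltW.
    exact: strip_continuous_slice cux (sTc _ sT).
  by move=> z; exact: dx.
have cutxt : continuous (utx t)
  by exact: strip_continuous_slice cutx (sTc _ tT).
have xI : x - 1 < x < x + 1 by rewrite ltrBlDr !ltrDl !ltr01.
have /andP[ax xb] := xI.
have [dF F'] := @continuous_FTC1_closed R (utx t) (x - 1) x (x + 1) xb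
  (continuous_integrable_itv _ _ cutxt) ax (cutxt x).
have d1 : is_derive x (1 : R)
    (fun y => \int[leb R]_(z in `[x - 1, y]) utx t z) (utx t x).
  by rewrite -F' derive1E; exact: derivableP.
have d2 := is_deriveD d1 (is_derive_cst (ut t (x - 1)) x 1).
apply: (is_derive_uniq dl).
rewrite addr0 in d2; apply: near_eq_is_derive d2.
by apply: filterS (near_itvoo xI) => y yI; rewrite (utE y yI).
Qed.

Lemma derive_ler0 (R : realType) (f df : R -> R) (a b : R) : a <= b ->
  {within `[a, b], continuous f} ->
  (forall x, a < x < b -> is_derive x (1 : R) f (df x)) ->
  (forall x, a < x < b -> df x <= 0) -> f b <= f a.
Proof.
rewrite le_eqVlt => /predU1P[<-//|ab] cf dfE df0.
have dfI x : x \in `]a, b[ -> is_derive x (1 : R) f (df x).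
  by rewrite in_itv/=; exact: dfE.
have [c /[!in_itv]/= cab E] := MVT ab dfI cf.
rewrite -subr_le0 E; apply: mulr_le0_ge0; first exact: df0.
by rewrite subr_ge0 ltW.
Qed.

Lemma derive_eq0 (R : realType) (f : R -> R) (a b : R) : a <= b ->
  {within `[a, b], continuous f} ->
  (forall x, a < x < b -> is_derive x (1 : R) f 0) -> f b = f a.
Proof.
rewrite le_eqVlt => /predU1P[<-//|ab] cf df0.
have dfI x : x \in `]a, b[ -> is_derive x (1 : R) f 0.
  by rewrite in_itv/=; exact: df0.
have [c _ /eqP] := @MVT _ f (fun=> 0) a b ab dfI cf.
by rewrite mul0r subr_eq0 => /eqP.
Qed.

(** * Characteristics of the wave equation *)

Lemma Ck_strip_continuous (R : realType) (T : R) (k : nat) (u : R -> R -> R) :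
  Ck_strip T k u -> strip_continuous T u.
Proof. by case: k => [|k] []. Qed.

Lemma Ck_strip_Dt (R : realType) (T : R) (k : nat) (u : R -> R -> R) :
  Ck_strip T k.+1 u -> Ck_strip T k (Dt T u).
Proof. by move=> [_ []]. Qed.

Lemma Ck_strip_Dx (R : realType) (T : R) (k : nat) (u : R -> R -> R) :
  Ck_strip T k.+1 u -> Ck_strip T k (Dx u).
Proof. by move=> [_ []]. Qed.

Lemma Ck_strip_derive_time (R : realType) (T : R) (k : nat) (u : R -> R -> R)
    (t x : R) : Ck_strip T k.+1 u -> 0 < t < T ->
  is_derive t (1 : R) (u ^~ x) (Dt T u t x).
Proof.
move=> [_ [+ _ _]] tT; have tTc : 0 <= t <= T by have /andP[? ?] := tT;
  rewrite !ltW.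
by move=> /(_ _ x tTc)[+ _]; exact: Dt_is_derive.
Qed.

Lemma Ck_strip_derive_space (R : realType) (T : R) (k : nat) (u : R -> R -> R)
    (t x : R) : Ck_strip T k.+1 u -> 0 <= t <= T ->
  is_derive x (1 : R) (u t) (Dx u t x).
Proof.
by move=> [_ [+ _ _]] tT => /(_ _ x tT)[_]; rewrite /Dx derive1E;
  exact: derivableP.
Qed.

Lemma Dx_Dt_comm (R : realType) (T : R) (u : R -> R -> R) (t x : R) :
  Ck_strip T 2 u -> 0 < t < T -> Dx (Dt T u) t x = Dt T (Dx u) t x.
Proof.
move=> cu tT.
have sTc s : 0 < s < T -> 0 <= s <= T by move=> /andP[s0 sT]; rewrite !ltW.
exact: (strip_derive_comm tT (Ck_strip_continuous (Ck_strip_Dx cu))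
  (Ck_strip_continuous (Ck_strip_Dt (Ck_strip_Dx cu)))
  (fun s y sT => Ck_strip_derive_time y cu sT)
  (fun s y sT => Ck_strip_derive_space y cu (sTc _ sT))
  (fun s y sT => Ck_strip_derive_time y (Ck_strip_Dx cu) sT)
  (Ck_strip_derive_space x (Ck_strip_Dt cu) (sTc _ tT))).
Qed.

(** The equation is kept in flux form, so that no derivative of [H], which is large in the layer,
    ever appears. *)
Lemma wave_solution_flux (R : realType) (T : R) (H g0 g1 : R -> R)
    (u : R -> R -> R) (t x : R) : wave_solution T H g0 g1 u -> 0 <= t <= T ->
  is_derive x (1 : R) (fun y => H y * Dx u t y) (Dt T (Dt T u) t x).
Proof.
move=> [_ eqn _ _] tT; have [d /eqP] := eqn t x tT.
by rewrite subr_eq0 => /eqP ->; rewrite derive1E; exact: derivableP.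
Qed.

(** The flux vanishes in a neighbourhood of [x], hence [u_tt = 0] there, and two integrations in
    time give an affine function of [t]. *)
Lemma wave_solution_left (R : realType) (T : R) (H g0 g1 : R -> R)
    (u : R -> R -> R) (b : R) : wave_solution T H g0 g1 u ->
  (forall x, x < b -> H x = 0) ->
  forall t x, 0 <= t <= T -> x < b -> u t x = g0 x + t * g1 x.
Proof.
move=> wu H0 t x tT xb; have [cu _ u0 u1] := wu.
have /andP[t0 tT'] := tT; have T0 := le_trans t0 tT'.
have sub r s : 0 <= r <= T -> `[0, r]%classic s -> 0 <= s <= T.
  by move=> /andP[_ rT]; rewrite /= in_itv/= => /andP[-> sr];
    exact: le_trans sr rT.
have lt_ r s : 0 <= r <= T -> 0 < s < r -> 0 < s < T.
  by move=> /andP[_ rT] /andP[-> sr]; exact: lt_le_trans sr rT.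
have sTc s : 0 < s < T -> 0 <= s <= T by move=> /andP[s0 sT]; rewrite !ltW.
have utt0 s : 0 <= s <= T -> Dt T (Dt T u) s x = 0.
  move=> sT; apply: (is_derive_uniq (wave_solution_flux x wu sT)).
  apply: near_eq_is_derive (is_derive_cst 0 x 1).
  by apply: filterS (lt_nbhsl xb) => y yb; rewrite H0// mul0r.
have utE s : 0 <= s <= T -> Dt T u s x = g1 x.
  move=> sT; rewrite -u1; apply: (@derive_eq0 _ (Dt T u ^~ x) 0 s).
  - by case/andP: sT.
  - exact: strip_continuous_time T0 (Ck_strip_continuous (Ck_strip_Dt cu))
      (fun r => sub s r sT).
  - move=> r rs; have rT := lt_ _ _ sT rs.
    have := Ck_strip_derive_time x (Ck_strip_Dt cu) rT.
    by rewrite (utt0 _ (sTc _ rT)).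
have: u t x - t * g1 x = u 0 x - 0 * g1 x.
  apply: (@derive_eq0 _ (fun s => u s x - s * g1 x) 0 t) => //.
    have cux : {within `[0, t], continuous (u ^~ x)}.
      exact: (strip_continuous_time T0 (Ck_strip_continuous cu)
        (fun r => sub t r tT)).
    have cl : continuous (fun s : R => s * g1 x).
      by move=> r; apply: cvgM; [exact: cvg_id|exact: cvg_cst].
    move=> s; apply: cvgB; first exact: cux.
    exact: (continuous_subspaceT cl).
  move=> s st; have sT := lt_ _ _ tT st.
  have d1 := Ck_strip_derive_time x cu sT.
  have d2 : is_derive s (1 : R) (fun s : R => s * g1 x) (g1 x).
    by apply: is_derive_eq; rewrite /GRing.scale/= mulr1 mulr0 add0r.
  by have := is_deriveB d1 d2; rewrite (utE _ (sTc _ sT)) subrr.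
by rewrite mul0r subr0 u0 => /eqP; rewrite subr_eq => /eqP.
Qed.

(** Followed backwards in time, the line [x + t = const] moves to the right and so never enters the
    layer. Along it the derivative of [u_t + u_x] is [u_tt - u_xx = 0], by symmetry of the mixed
    derivatives. *)
Lemma wave_solution_outgoing (R : realType) (T : R) (H g0 g1 : R -> R)
    (u : R -> R -> R) (a : R) : wave_solution T H g0 g1 u ->
  (forall x, a <= x -> H x = 1) ->
  (forall x, a <= x -> g1 x + derive1 g0 x = 0) ->
  forall t x, 0 <= t <= T -> a <= x -> Dt T u t x + Dx u t x = 0.
Proof.
move=> wu H1 g01 t x tT ax; have [cu _ u0 u1] := wu.
have /andP[t0 tT'] := tT; have T0 := le_trans t0 tT'.
have cut := Ck_strip_Dt cu; have cux := Ck_strip_Dx cu.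
pose c := x + t.
have -> : x = c + (-1) * t by rewrite /c mulN1r addrK.
have cc : continuous (fun s : R => c + (-1) * s).
  move=> s; apply: cvgD; first exact: cvg_cst.
  by apply: cvgM; [exact: cvg_cst|exact: cvg_id].
have F0 : Dt T u 0 (c + (-1) * 0) + Dx u 0 (c + (-1) * 0) = 0.
  rewrite u1 mulr0 addr0 /Dx (_ : u 0 = g0); last exact/funext.
  by apply: g01; rewrite (le_trans ax)// lerDl.
rewrite -F0.
apply: (@derive_eq0 _ (fun s =>
  Dt T u s (c + (-1) * s) + Dx u s (c + (-1) * s)) 0 t t0).
  have sub s : `[0, t]%classic s -> 0 <= s <= T.
    by rewrite /= in_itv/= => /andP[-> st]; exact: le_trans st tT'.
  move=> s; apply: cvgD.
    exact: (strip_continuous_path T0 (Ck_strip_continuous cut) (fun=> cvg_id)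
      cc sub).
  exact: (strip_continuous_path T0 (Ck_strip_continuous cux) (fun=> cvg_id) cc
    sub).
move=> s /andP[s0 st]; have sT : 0 < s < T by rewrite s0 (lt_le_trans st).
have sTc r : 0 < r < T -> 0 <= r <= T by move=> /andP[r0 rT]; rewrite !ltW.
have d1 := strip_derive_line (k := -1) (c := c) sT (Ck_strip_continuous
  (Ck_strip_Dx cut))
  (Ck_strip_derive_time (c + (-1) * s) cut sT)
  (fun r y rT => Ck_strip_derive_space y cut (sTc _ rT)).
have d2 := strip_derive_line (k := -1) (c := c) sT (Ck_strip_continuous
  (Ck_strip_Dx cux))
  (Ck_strip_derive_time (c + (-1) * s) cux sT)
  (fun r y rT => Ck_strip_derive_space y cux (sTc _ rT)).
have := is_deriveD d1 d2; congr is_derive.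
rewrite Dx_Dt_comm// (_ : Dt T (Dt T u) s _ = Dx (Dx u) s (c + (-1) * s)).
  by ring.
apply: (is_derive_uniq (wave_solution_flux _ wu (sTc _ sT))).
(* Strict because [s < t]: the flux can be replaced by [u_x] only on a whole neighbourhood. The
   endpoint [s = t], which may lie on [x = a], is reached by continuity. *)
have ac : a < c + (-1) * s by rewrite /c; lra.
apply: near_eq_is_derive (Ck_strip_derive_space _ cux (sTc _ sT)).
by apply: filterS (lt_nbhsr ac) => y /ltW ay; rewrite H1// mul1r.
Qed.

(** The starting time [s] is free for the sake of two uses: [s = 0] reaches the initial data, and
    [s = t - (x - a)] reaches the trace at [x = a]. *)
Lemma wave_solution_right (R : realType) (T : R) (H g0 g1 : R -> R)
    (u : R -> R -> R) (a : R) : wave_solution T H g0 g1 u ->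
  (forall x, a <= x -> H x = 1) ->
  (forall x, a <= x -> g1 x + derive1 g0 x = 0) ->
  forall s t x, 0 <= s <= t -> t <= T -> a <= x - (t - s) ->
  u t x = u s (x - (t - s)).
Proof.
move=> wu H1 g01 s t x /andP[s0 st] tT ax; have [cu _ u0 u1] := wu.
have t0 := le_trans s0 st; have T0 := le_trans t0 tT.
pose c := x - t.
have cE r : x - (t - r) = c + 1 * r by rewrite mul1r /c opprB addrCA addrC.
rewrite cE in ax *; have -> : x = c + 1 * t by rewrite mul1r subrK.
have cc : continuous (fun s : R => c + 1 * s).
  move=> r; apply: cvgD; first exact: cvg_cst.
  by apply: cvgM; [exact: cvg_cst|exact: cvg_id].
apply: (@derive_eq0 _ (fun s => u s (c + 1 * s)) s t) => //.
  have sub r : `[s, t]%classic r -> 0 <= r <= T.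
    rewrite /= in_itv/= => /andP[sr rt].
    by rewrite (le_trans s0 sr) (le_trans rt tT).
  exact: (strip_continuous_path T0 (Ck_strip_continuous cu) (fun=> cvg_id) cc
    sub).
move=> r /andP[sr rt].
have rT : 0 < r < T by rewrite (le_lt_trans s0 sr) (lt_le_trans rt tT).
have rTc q : 0 < q < T -> 0 <= q <= T by move=> /andP[q0 qT]; rewrite !ltW.
rewrite -(@wave_solution_outgoing _ T H g0 g1 u a wu H1 g01 r (c + 1 * r) (rTc
  _ rT)).
  rewrite -[X in _ + X]mul1r.
  apply: (strip_derive_line (k := 1) (c := c) rT (Ck_strip_continuous
    (Ck_strip_Dx cu))
    (Ck_strip_derive_time (c + 1 * r) cu rT)).
  exact: (fun r y rT => Ck_strip_derive_space y cu (rTc _ rT)).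
by rewrite (le_trans ax)// lerD2l !mul1r ltW.
Qed.

(** * Energy in the transition layer *)

Lemma strip_continuousD (R : realType) (T : R) (f g : R -> R -> R) :
  strip_continuous T f -> strip_continuous T g ->
  strip_continuous T (fun t x => f t x + g t x).
Proof. by move=> cf cg p; apply: cvgD; [exact: cf|exact: cg]. Qed.

Lemma strip_continuousM (R : realType) (T : R) (f g : R -> R -> R) :
  strip_continuous T f -> strip_continuous T g ->
  strip_continuous T (fun t x => f t x * g t x).
Proof. by move=> cf cg p; apply: cvgM; [exact: cf|exact: cg]. Qed.

Lemma strip_continuous_space_fun (R : realType) (T : R) (h : R -> R) :
  continuous h -> strip_continuous T (fun _ x => h x).
Proof.
move=> ch; apply: continuous_subspaceT => -[s y].
apply: (@cvg_comp _ _ _ (@snd R R) h); first exact: cvg_snd.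
exact: ch.
Qed.

Lemma strip_continuous_time_fun (R : realType) (T : R) (h : R -> R) :
  continuous h -> strip_continuous T (fun t _ => h t).
Proof.
move=> ch; apply: continuous_subspaceT => -[s y].
apply: (@cvg_comp _ _ _ (@fst R R) h); first exact: cvg_fst.
exact: ch.
Qed.

Lemma strip_continuous_cst (R : realType) (T c : R) :
  strip_continuous T (fun _ _ => c).
Proof. by apply: strip_continuous_space_fun => x; exact: cvg_cst. Qed.

Lemma is_derive_sqr (R : realType) (f : R -> R) (x l : R) :
  is_derive x (1 : R) f l -> is_derive x (1 : R) (fun y =>
    f y * f y) (2 * (f x * l)).
Proof.
move=> df; have := is_deriveM df df; congr is_derive.
by rewrite /GRing.scale/=; ring.
Qed.

(** Twice the physical energy, whence the factor 2 in its derivative. *)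
Definition layer_energy (R : realType) (T a : R) (H : R -> R) (u : R -> R -> R)
    (t : R) : R :=
  \int[leb R]_(x in `[- a, a])
    (Dt T u t x * Dt T u t x + H x * (Dx u t x * Dx u t x)).

Lemma strip_continuous_energy (R : realType) (T : R) (H : R -> R)
    (u : R -> R -> R) : continuous H -> Ck_strip T 2 u ->
  strip_continuous T
    (fun t x => Dt T u t x * Dt T u t x + H x * (Dx u t x * Dx u t x)).
Proof.
move=> cH cu; have cut := Ck_strip_continuous (Ck_strip_Dt cu).
have cux := Ck_strip_continuous (Ck_strip_Dx cu).
apply: strip_continuousD; first exact: strip_continuousM.
apply: strip_continuousM; first exact: strip_continuous_space_fun.
exact: strip_continuousM.
Qed.

Lemma layer_energy_continuous (R : realType) (T a : R) (H : R -> R)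
    (u : R -> R -> R) : 0 <= T -> continuous H -> Ck_strip T 2 u ->
  {within `[0, T], continuous (layer_energy T a H u)}.
Proof.
move=> T0 cH cu.
exact: (strip_integral_continuous T0 (strip_continuous_energy cH cu)).
Qed.

Lemma derive_layer_energy (R : realType) (T a : R) (H g0 g1 : R -> R)
    (u : R -> R -> R) (t : R) : 0 <= a -> continuous H ->
  H (- a) = 0 -> H a = 1 -> wave_solution T H g0 g1 u ->
  (forall s, 0 <= s <= T -> Dt T u s a + Dx u s a = 0) ->
  0 < t < T ->
  is_derive t (1 : R) (layer_energy T a H u) (- 2 * Dt T u t a ^+ 2).
Proof.
move=> a0 cH Ha0 Ha1 wu ua tT; have [cu _ _ _] := wu.
have sTc s : 0 < s < T -> 0 <= s <= T by move=> /andP[s0 sT]; rewrite !ltW.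
have cut := Ck_strip_Dt cu; have cux := Ck_strip_Dx cu.
pose e' s x := 2 * (Dt T u s x * Dt T (Dt T u) s x +
  H x * (Dx u s x * Dt T (Dx u) s x)).
have ce' : strip_continuous T e'.
  apply: strip_continuousM; first exact: strip_continuous_cst.
  apply: strip_continuousD; apply: strip_continuousM.
  - exact: Ck_strip_continuous cut.
  - exact: Ck_strip_continuous (Ck_strip_Dt cut).
  - exact: strip_continuous_space_fun.
  - apply: strip_continuousM; first exact: Ck_strip_continuous cux.
    exact: Ck_strip_continuous (Ck_strip_Dt cux).
have d1 : is_derive t (1 : R) (layer_energy T a H u)
    (\int[leb R]_(x in `[- a, a]) e' t x).
  apply: (strip_derive_integral (strip_continuous_energy cH cu) ce' tT).
  move=> s x sT _.
  have dt := is_derive_sqr (Ck_strip_derive_time x cut sT).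
  have dx := is_derive_sqr (Ck_strip_derive_time x cux sT).
  have := is_deriveD dt (is_deriveZ (H x) dx); congr is_derive.
  rewrite /e' /GRing.scale/=.
  move: (Dt T u s x) (Dt T (Dt T u) s x) (Dx u s x) (Dt T (Dx u) s x).
  by move=> p q r v; ring.
suff <- : \int[leb R]_(x in `[- a, a]) e' t x = - 2 * Dt T u t a ^+ 2 by [].
(* [F] is the flux of this energy: its space derivative is [e'] by the equation and the symmetry of
   mixed derivatives. It vanishes at [- a] with [H]; at [a], where [H = 1], the outgoing condition
   turns [u_x] into [- u_t]. *)
pose F y := 2 * (H y * Dx u t y * Dt T u t y).
have dF x : is_derive x (1 : R) F (e' t x).
  have df := wave_solution_flux x wu (sTc _ tT).
  have dg := Ck_strip_derive_space x cut (sTc _ tT).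
  have := is_deriveZ 2 (is_deriveM df dg); congr is_derive.
  rewrite /e' /GRing.scale/= -Dx_Dt_comm//.
  move: (Dt T u t x) (Dt T (Dt T u) t x) (Dx u t x) (Dx (Dt T u) t x).
  by move=> p q r v; ring.
have a2 : - a <= a by lra.
rewrite (Rintegral_FTC2 a2 (strip_continuous_slice ce' (sTc _ tT)) dF).
rewrite /F Ha0 Ha1.
have -> : Dx u t a = - Dt T u t a by apply/eqP;
  rewrite -addr_eq0 addrC ua// sTc.
by ring.
Qed.

Lemma le_Rintegral_cst (R : realType) (a b c : R) (f : R -> R) : a <= b ->
  continuous f -> (forall x, a <= x <= b -> f x <= c) ->
  \int[leb R]_(x in `[a, b]) f x <= c * (b - a).
Proof.
move=> ab cf fc.
have -> : c * (b - a) = \int[leb R]_(x in `[a, b]) (fun=> c) x.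
  rewrite Rintegral_cst//; congr (_ * _); apply: EFin_inj.
  have := @lebesgue_measure_itv R `[a, b]; rewrite /= lte_fin => E.
  rewrite [in RHS]fineK; first by rewrite E; case: ltgtP ab => // ->;
    rewrite subrr.
  by rewrite E; case: ifP.
apply: le_Rintegral => //.
- exact: continuous_integrable_itv.
- exact: integrable_cst_itv.
Qed.

Lemma layer_energy_ge (R : realType) (T a : R) (H : R -> R)
    (u : R -> R -> R) (t : R) : continuous H -> (forall x, 0 <= H x) ->
  Ck_strip T 2 u -> 0 <= t <= T ->
  \int[leb R]_(x in `[- a, a]) (Dt T u t x * Dt T u t x) <= layer_energy T a H
    u t.
Proof.
move=> cH H0 cu tT; have cut := Ck_strip_continuous (Ck_strip_Dt cu).
apply: le_Rintegral => //.
- apply: continuous_integrable_itv.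
  exact: (strip_continuous_slice (strip_continuousM cut cut) tT).
- apply: continuous_integrable_itv.
  exact: (strip_continuous_slice (strip_continuous_energy cH cu) tT).
- by move=> x _; rewrite lerDl mulr_ge0// -expr2 sqr_ge0.
Qed.

Lemma itv_cc_sub (R : realType) (t T : R) : 0 <= t <= T ->
  `[0, t]%classic `<=` (`[0, T]%classic : set R).
Proof.
by move=> /andP[_ tT] s /=; rewrite !in_itv/= => /andP[-> /le_trans]; apply.
Qed.

(* The energy lost to the outgoing wave controls the trace at [a]: the
   derivative of [E + lam u(., a) - lam^2 t / 8] is
   [- 2 (u_t(., a) - lam / 4)^2]. *)
Lemma layer_trace (R : realType) (T a : R) (H g0 g1 : R -> R)
    (u : R -> R -> R) (t lam : R) : 0 <= a -> continuous H ->
  (forall x, 0 <= H x) -> H (- a) = 0 -> H a = 1 -> wave_solution T H g0 g1 u ->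
  (forall s, 0 <= s <= T -> Dt T u s a + Dx u s a = 0) -> 0 <= t <= T ->
  layer_energy T a H u t + lam * (u t a - u 0 a) <=
  layer_energy T a H u 0 + lam ^+ 2 * t / 8.
Proof.
move=> a0 cH H0 Ha0 Ha1 wu ua tT; have [cu _ _ _] := wu.
have /andP[t0 tT'] := tT; have T0 := le_trans t0 tT'.
pose f s := layer_energy T a H u s + (lam * u s a - lam ^+ 2 / 8 * s).
suff : f t <= f 0.
  rewrite /f; move: (layer_energy T a H u t) (layer_energy T a H u 0) (u t a)
    (u 0 a).
  by move=> J J0 v v0; lra.
pose df s := - 2 * Dt T u s a ^+ 2 + (lam * Dt T u s a - lam ^+ 2 / 8).
apply: (@derive_ler0 _ f df 0 t t0).
- have cJ := continuous_subspaceW (itv_cc_sub tT) (layer_energy_continuous T0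
    cH cu).
  have c1 : {within `[0, t], continuous (u ^~ a)}.
    apply: (strip_continuous_time T0 (Ck_strip_continuous cu)) => s.
    by move/(itv_cc_sub tT); rewrite /= in_itv.
  have c2 : {within `[0, t], continuous (fun s : R => lam ^+ 2 / 8 * s)}.
    by apply: continuous_subspaceT => s; apply: cvgM;
      [exact: cvg_cst|exact: cvg_id].
  move=> s; apply: cvgD; first exact: cJ.
  apply: cvgB; last exact: c2.
  by apply: cvgM; [exact: cvg_cst|exact: c1].
- move=> s /andP[s0 st]; have sT : 0 < s < T by rewrite s0 (lt_le_trans st).
  have d1 := derive_layer_energy a0 cH Ha0 Ha1 wu ua sT.
  have d2 := is_deriveZ lam (Ck_strip_derive_time a cu sT).
  have d3 := is_deriveZ (lam ^+ 2 / 8) (is_derive_id s (1 : R)).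
  have := is_deriveD d1 (is_deriveB d2 d3); congr is_derive.
  by rewrite /df /GRing.scale/= mulr1.
- move=> s _; rewrite /df; move: (Dt T u s a) => p.
  by have := sqr_ge0 (p - lam / 4); nra.
Qed.

Lemma layer_energy_ge0 (R : realType) (T a : R) (H : R -> R)
    (u : R -> R -> R) (t : R) : (forall x, 0 <= H x) ->
  0 <= layer_energy T a H u t.
Proof.
move=> H0; apply: Rintegral_ge0 => x _.
apply: addr_ge0; first by rewrite -expr2 sqr_ge0.
by apply: mulr_ge0 => //; rewrite -expr2 sqr_ge0.
Qed.

(** The case [lam = 0] of [layer_trace]. *)
Lemma layer_energy_le (R : realType) (T a : R) (H g0 g1 : R -> R)
    (u : R -> R -> R) (t : R) : 0 <= a -> continuous H ->
  (forall x, 0 <= H x) -> H (- a) = 0 -> H a = 1 -> wave_solution T H g0 g1 u ->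
  (forall s, 0 <= s <= T -> Dt T u s a + Dx u s a = 0) -> 0 <= t <= T ->
  layer_energy T a H u t <= layer_energy T a H u 0.
Proof.
move=> a0 cH H0 Ha0 Ha1 wu ua tT.
have := layer_trace 0 a0 cH H0 Ha0 Ha1 wu ua tT.
move: (layer_energy T a H u t) (layer_energy T a H u 0) (u t a - u 0 a).
by move=> J J0 d; rewrite expr0n/= !mul0r !addr0.
Qed.

(* The weight [T + 1 - s] absorbs the growth of the squared displacement:
   [- w^2 + 2 c w w_t <= c^2 w_t^2]. *)
Lemma layer_displacement (R : realType) (T a : R) (H g0 g1 : R -> R)
    (u : R -> R -> R) (t : R) : 0 <= a -> continuous H ->
  (forall x, 0 <= H x) -> H (- a) = 0 -> H a = 1 -> wave_solution T H g0 g1 u ->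
  (forall s, 0 <= s <= T -> Dt T u s a + Dx u s a = 0) -> continuous g0 ->
  0 <= t <= T ->
  \int[leb R]_(x in `[- a, a]) ((u t x - g0 x) * (u t x - g0 x)) <=
  (T + 1) ^+ 2 * T * layer_energy T a H u 0.
Proof.
move=> a0 cH H0 Ha0 Ha1 wu ua cg0 tT; have [cu _ u0 _] := wu.
have /andP[t0 tT'] := tT; have T0 := le_trans t0 tT'.
have sTc s : 0 < s < T -> 0 <= s <= T by move=> /andP[s0 sT]; rewrite !ltW.
have cut := Ck_strip_Dt cu; have cuc := Ck_strip_continuous cu.
pose w s x := u s x + - g0 x.
pose ww s x := w s x * w s x.
have cw : strip_continuous T w.
  apply: strip_continuousD cuc _; apply: strip_continuous_space_fun => x.
  by apply: cvgN; exact: cg0.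
have cww : strip_continuous T ww by exact: strip_continuousM.
pose q s x := (T + 1 + - s) * ww s x.
have cc : strip_continuous T (fun s _ => T + 1 + - s).
  apply: strip_continuous_time_fun => s.
  by apply: cvgB; [exact: cvg_cst|exact: cvg_id].
have cq : strip_continuous T q by exact: strip_continuousM.
pose q' s x := (T + 1 + - s) * (2 * (w s x * Dt T u s x)) + (-1) * ww s x.
have cq' : strip_continuous T q'.
  apply: strip_continuousD; apply: strip_continuousM => //.
  - apply: strip_continuousM; first exact: strip_continuous_cst.
    by apply: strip_continuousM => //; exact: Ck_strip_continuous cut.
  - exact: strip_continuous_cst.
pose Q s := \int[leb R]_(x in `[- a, a]) q s x.
pose J0 := layer_energy T a H u 0.
have J0ge : 0 <= J0 by exact: layer_energy_ge0.
pose Q' s := \int[leb R]_(x in `[- a, a]) q' s x.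
have dQ s : 0 < s < T -> is_derive s (1 : R) Q (Q' s).
  move=> sT; apply: (strip_derive_integral cq cq' sT) => r x rT _.
  have d1 := Ck_strip_derive_time x cu rT.
  have d2 := is_deriveB d1 (is_derive_cst (g0 x) r 1).
  have d3 := is_derive_sqr d2.
  have d4 := is_deriveB (is_derive_cst (T + 1) r (1 : R)) (is_derive_id r (1 :
    R)).
  have := is_deriveM d4 d3; congr is_derive.
  rewrite /q' /ww /w /GRing.scale/= !fctE.
  by move: (Dt T u r x) (u r x) (g0 x) => p v g; ring.
have le1 s : 0 < s < T -> Q' s <= (T + 1) ^+ 2 * J0.
  move=> sT; have cutut := strip_continuousM (Ck_strip_continuous cut)
    (Ck_strip_continuous cut).
  apply: (@le_trans _ _ (\int[leb R]_(x in `[- a, a])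
      ((T + 1) ^+ 2 * (Dt T u s x * Dt T u s x)))).
    apply: le_Rintegral => //.
    - apply: continuous_integrable_itv.
      exact: (strip_continuous_slice cq' (sTc _ sT)).
    - apply: continuous_integrable_itv.
      exact: (strip_continuous_slice (strip_continuousM
        (@strip_continuous_cst R T ((T + 1) ^+ 2)) cutut) (sTc _ sT)).
    - move=> x _; rewrite /q' /ww.
      move: (w s x) (Dt T u s x) => y p; have /andP[s0 sT'] := sT.
      set c := T + 1 + - s.
      have c0 : 0 <= c by rewrite /c; lra.
      have cT : c <= T + 1 by rewrite /c; lra.
      have h1 : c ^+ 2 * (p * p) <= (T + 1) ^+ 2 * (p * p).
        by rewrite ler_wpM2r// -?expr2 ?sqr_ge0// lerXn2r// nnegrE; lra.
      by have h2 := sqr_ge0 (y - c * p); nra.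
  rewrite RintegralZl//; last first.
    by apply: continuous_integrable_itv;
      exact: (strip_continuous_slice cutut (sTc _ sT)).
  rewrite ler_wpM2l ?sqr_ge0//.
  apply: le_trans (layer_energy_ge a cH H0 cu (sTc _ sT)) _.
  exact: layer_energy_le a0 cH H0 Ha0 Ha1 wu ua (sTc _ sT).
have QQ : Q t - (T + 1) ^+ 2 * J0 * t <= Q 0 - (T + 1) ^+ 2 * J0 * 0.
  pose df s := Q' s - (T + 1) ^+ 2 * J0.
  apply: (@derive_ler0 _ (fun s => Q s - (T + 1) ^+ 2 * J0 * s) df 0 t t0).
  - have c1 : {within `[0, t], continuous Q}.
      exact: continuous_subspaceW (itv_cc_sub tT) (strip_integral_continuous T0
        cq).
    have c2 : {within `[0, t], continuous (fun s : R => (T + 1) ^+ 2 * J0 * s)}.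
      by apply: continuous_subspaceT => s; apply: cvgM;
        [exact: cvg_cst|exact: cvg_id].
    by move=> s; apply: cvgB; [exact: c1|exact: c2].
  - move=> s /andP[s0 st]; have sT : 0 < s < T by rewrite s0 (lt_le_trans st).
    have d3 := is_deriveZ ((T + 1) ^+ 2 * J0) (is_derive_id s (1 : R)).
    have := is_deriveB (dQ s sT) d3; congr is_derive.
    by rewrite /df /GRing.scale/= mulr1.
  - move=> s /andP[s0 st]; rewrite /df subr_le0; apply: le1.
    by rewrite s0 (lt_le_trans st).
have Q0 : Q 0 = 0.
  rewrite /Q (_ : (fun x => q 0 x) = fun=> 0); last first.
    by apply/funext => x; rewrite /q /ww /w u0 subrr !mulr0.
  by rewrite Rintegral_cst// mul0r.
(* The weight [T + 1 - t] is at least 1, so [Q t] dominates the unweighted integral. *)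
apply: (@le_trans _ _ (Q t)).
  apply: le_Rintegral => //.
  - by apply: continuous_integrable_itv; exact: (strip_continuous_slice cww tT).
  - by apply: continuous_integrable_itv; exact: (strip_continuous_slice cq tT).
  - move=> x _; rewrite /q /ww /w; apply: ler_peMl;
      first by rewrite -expr2 sqr_ge0.
    by lra.
apply: (@le_trans _ _ ((T + 1) ^+ 2 * J0 * t)); first by rewrite Q0 in QQ; lra.
rewrite -mulrA [J0 * t]mulrC mulrA ler_wpM2r//.
by rewrite ler_wpM2l ?sqr_ge0.
Qed.

(** * Mollified Heaviside function *)

Lemma smooth_is_derive (R : realType) (f : R -> R) (x : R) : smooth f ->
  is_derive x (1 : R) f (derive1 f x).
Proof. by move=> /(_ 0%N x) df; rewrite derive1E; exact: derivableP. Qed.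

Lemma smooth_derive_continuous (R : realType) (f : R -> R) : smooth f ->
  continuous (derive1 f).
Proof.
move=> sf x; apply: differentiable_continuous; apply/derivable1_diffP.
exact: (sf 1%N x).
Qed.

Lemma bounded_off_support (R : realType) (f : R -> R) (M : R) :
  continuous f -> (forall x, M <= `|x| -> f x = 0) ->
  exists B : R, forall x, `|f x| <= B.
Proof.
move=> cf f0.
have : compact (f @` `[- M, M]).
  by apply: continuous_compact; [exact: continuous_subspaceT|exact:
    segment_compact].
move=> /compact_bounded [B [_ /(_ (B + 1))]].
rewrite ltrDl ltr01 => /(_ isT) fB; exists (Num.max 0 (B + 1)) => x.
have [xM|Mx] := leP `|x| M.
  rewrite le_max; apply/orP; right; apply: fB; exists x => //=.
  by rewrite in_itv/= -ler_norml.
by rewrite f0 ?normr0 ?le_max ?lexx// ltW.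
Qed.

(** A single constant serves as bound and as radius of the support, for [f] and its derivative
    together. *)
Lemma test_function_bounds (R : realType) (f : R -> R) : test_function f ->
  exists2 B : R, 0 < B & forall x, [/\ `|f x| <= B, `|derive1 f x| <= B,
    B <= `|x| -> f x = 0 & B <= `|x| -> derive1 f x = 0].
Proof.
move=> [sf /compact_bounded[M [_ /(_ (M + 1))]]].
rewrite ltrDl ltr01 => /(_ isT) fM.
have f0 x : M + 1 < `|x| -> f x = 0.
  move=> Mx; apply/eqP; apply: contraTT Mx => fx0; rewrite -leNgt.
  by apply: fM; apply: subset_closure.
have df0 x : M + 1 < `|x| -> derive1 f x = 0.
  move=> Mx; apply: (is_derive_uniq (smooth_is_derive x sf)).
  apply: near_eq_is_derive (is_derive_cst 0 x 1).
  have nx : \forall y \near x, M + 1 < `|y| :=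
    @norm_continuous _ R^o x _ (lt_nbhsr Mx).
  by apply: filterS nx => y My; rewrite f0.
have cf : continuous f by exact: is_derive_continuous (fun x =>
  smooth_is_derive x sf).
(* [f0] and [df0] hold on the open region [M + 1 < |x|], open so that [f] could be differentiated
   there; [M + 2] is a radius for the nonstrict inequality. *)
have [B1 hB1] := @bounded_off_support _ f (M + 2) cf (fun x Mx =>
  f0 x ltac:(lra)).
have [B2 hB2] := @bounded_off_support _ _ (M + 2) (smooth_derive_continuous sf)
  (fun x Mx => df0 x ltac:(lra)).
exists (1 + `|M + 2| + `|B1| + `|B2|).
  by rewrite !addrA -!addrA ltr_pwDl// !addr_ge0.
move=> x; have := normr_ge0 (M + 2); have := normr_ge0 B1.
have := normr_ge0 B2; have := ler_norm (M + 2); have := ler_norm B1.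
have := ler_norm B2; have := hB1 x; have := hB2 x => *; split; try lra.
- by move=> xB; apply: f0; lra.
- by move=> xB; apply: df0; lra.
Qed.

(** Were the integral of the nonnegative [phi] infinite, its real value would default to 0,
    contradicting the normalisation to 1. *)
Lemma mollifier_integrable (R : realType) (phi : R -> R) : mollifier phi ->
  (leb R).-integrable setT (EFin \o phi).
Proof.
move=> [[sphi _] phi0 phi1].
have cphi : continuous phi by exact: is_derive_continuous (fun x =>
  smooth_is_derive x sphi).
apply/integrableP; split.
  apply/measurable_EFinP; exact: continuous_measurable_fun.
rewrite (_ : (fun x => _) = EFin \o phi); last first.
  by apply/funext => x /=; rewrite ger0_norm.
rewrite ltey; apply/eqP => E; move: phi1; rewrite /Rintegral.
rewrite (_ : (\int[leb R]_x (phi x)%:E)%E = +oo%E)//= => /eqP.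
by rewrite eq_sym oner_eq0.
Qed.

(** The distribution function of [phi] seen as a probability density. Up to scaling it is the
    mollified Heaviside function, which makes the range and the two plateaus of the latter
    evident. *)
Definition mollifier_cdf (R : realType) (phi : R -> R) (z : R) : R :=
  \int[leb R]_(x in `]-oo, z]) phi x.

Lemma derive_mollifier_cdf (R : realType) (phi : R -> R) (z : R) :
  mollifier phi -> is_derive z (1 : R) (mollifier_cdf phi) (phi z).
Proof.
move=> mphi; have iphi := mollifier_integrable mphi;
  have [[sphi _] _ _] := mphi.
have cphi : continuous phi by exact: is_derive_continuous (fun x =>
  smooth_is_derive x sphi).
have zz : z < z + 1 by rewrite ltrDl.
have iz : (leb R).-integrable `]-oo, (z + 1)] (EFin \o phi).
  exact: integrableS iphi.
have [||d E] := @continuous_FTC1 R phi (BInfty R true) z (z + 1) zz iz.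
- by rewrite ltNyr.
- exact: cphi.
by rewrite -E derive1E; exact: derivableP.
Qed.

Lemma mollifier_cdf0 (R : realType) (phi : R -> R) (K z : R) :
  (forall x, K <= `|x| -> phi x = 0) -> z <= - K -> mollifier_cdf phi z = 0.
Proof.
move=> phiK zK; rewrite /mollifier_cdf.
transitivity (\int[leb R]_(x in `]-oo, z]) (fun=> 0 : R) x).
  apply: eq_Rintegral => x /set_mem; rewrite /= in_itv/= => xz.
  by apply: phiK; rewrite -normrN (le_trans _ (ler_norm _))//; lra.
by rewrite Rintegral_cst// mul0r.
Qed.

Lemma mollifier_cdf1 (R : realType) (phi : R -> R) (K z : R) : mollifier phi ->
  (forall x, K <= `|x| -> phi x = 0) -> K <= z -> mollifier_cdf phi z = 1.
Proof.
move=> [_ _ <-] phiK zK; rewrite /mollifier_cdf Rintegral_mkcond.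
congr Rintegral; apply/funext => x; rewrite patchE; case: ifPn => // /negP xz.
rewrite phiK// (le_trans zK)// (le_trans _ (ler_norm _))// leNgt;
  apply/negP => xz'.
by apply: xz; apply/mem_set; rewrite /= in_itv/= ltW.
Qed.

Lemma mollifier_cdf_itv (R : realType) (phi : R -> R) (K z : R) : mollifier phi
  ->
  (forall x, K <= `|x| -> phi x = 0) -> 0 <= mollifier_cdf phi z <= 1.
Proof.
move=> mphi phiK; have [_ phi0 _] := mphi; apply/andP; split.
  by apply: Rintegral_ge0 => x _.
(* The distribution function is nondecreasing and equals 1 from [K] on; [z] is compared with a point
   beyond both. *)
have zm : z <= Num.max z K by rewrite le_max lexx.
rewrite -(@mollifier_cdf1 _ phi K (Num.max z K))//;
  last by rewrite le_max lexx orbT.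
rewrite -lerN2.
have dN x : is_derive x (1 : R) (- mollifier_cdf phi) (- phi x).
  exact: is_deriveN (derive_mollifier_cdf x mphi).
apply: (@derive_ler0 _ (- mollifier_cdf phi) (fun x => - phi x) z _ zm).
- exact: continuous_subspaceT (is_derive_continuous dN).
- by move=> x _; rewrite oppr_le0.
Qed.

(** No change of variables is made: the integrand lives on a bounded segment, where it has the
    primitive [- mollifier_cdf phi ((x - y) / w)]. *)
Lemma conv_heaviside_rescale (R : realType) (phi : R -> R) (K w x : R) :
  mollifier phi -> (forall x, K <= `|x| -> phi x = 0) -> 0 <= K -> 0 < w ->
  Defs.conv (@heaviside R) (rescale phi w) x = mollifier_cdf phi (x / w).
Proof.
move=> mphi phiK K0 w0; have [[sphi _] _ _] := mphi.
have cphi : continuous phi by exact: is_derive_continuous (fun x =>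
  smooth_is_derive x sphi).
(* For [y >= b] the argument [(x - y) / w] is at most [- K], so both the integrand and the primitive
   vanish there. *)
pose b : R := `|x| + K * w.
have b0 : 0 <= b by rewrite addr_ge0// mulr_ge0// ltW.
have xb (y : R) : b <= y -> (x - y) / w <= - K.
  rewrite ler_pdivrMr// => by_; have := ler_norm x; rewrite /b in by_ *; nra.
have -> : Defs.conv (@heaviside R) (rescale phi w) x =
    \int[leb R]_(y in `[0, b]) (w^-1 * phi ((x - y) / w)).
  rewrite /Defs.conv [RHS]Rintegral_mkcond; congr Rintegral; apply/funext => y.
  rewrite patchE /heaviside /rescale; have [y0|y0] := leP 0 y; last first.
    by rewrite memNset ?mul0r//= in_itv/= leNgt y0.
  have [yb|yb] := leP y b; first by rewrite mem_set ?mul1r//= in_itv/= y0.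
  rewrite memNset; last by rewrite /= in_itv/= y0/= leNgt yb.
  rewrite phiK ?mulr0// -normrN (le_trans _ (ler_norm _))// lerNr.
  exact/xb/ltW.
have dl (y : R) : is_derive y (1 : R) (fun y : R => (x - y) / w) (- w^-1).
  have := is_deriveZ w^-1 (is_deriveB (is_derive_cst x y (1 : R)) (is_derive_id
    y (1 : R))).
  rewrite [X in is_derive _ _ X](_ : _ = fun y => (x - y) / w).
    by congr is_derive; rewrite /GRing.scale/= sub0r mulrN1.
  by apply/funext => z; rewrite /GRing.scale/= mulrC.
have dF (y : R) : is_derive y (1 : R) (fun y =>
  - mollifier_cdf phi ((x - y) / w))
    (w^-1 * phi ((x - y) / w)).
  have dc := derive_mollifier_cdf ((x - y) / w) mphi.
  have := is_deriveN (@is_derive1_comp R (mollifier_cdf phi) (fun y : R =>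
    (x - y) / w) y _ _ dc (dl y)); congr is_derive.
  by rewrite mulrN opprK /GRing.scale/= mulrC.
rewrite (Rintegral_FTC2 b0 _ dF); last first.
  move=> y; apply: cvgM; first exact: cvg_cst.
  apply: (@continuous_comp _ _ _ (fun y : R => (x - y) / w) phi);
    last exact: cphi.
  exact: (is_derive_continuous dl).
by rewrite subr0 (mollifier_cdf0 phiK (xb b (lexx _))) oppr0 sub0r opprK.
Qed.

(** * Square-integrable functions and the limit solution *)

Lemma L2norm_itv (R : realType) (f : R -> R) (a b : R) : continuous f ->
  (forall x, ~~ (a <= x <= b) -> f x = 0) ->
  L2norm f = (Num.sqrt (\int[leb R]_(x in `[a, b]) (f x * f x)))%:E.
Proof.
move=> cf f0; rewrite /L2norm unlock /=.
have cff : continuous (fun x => f x * f x).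
  by move=> x; apply: cvgM; exact: cf.
have iff_ := continuous_integrable_itv a b cff.
rewrite [X in (X `^ _)%E](_ : _ = (\int[leb R]_(x in `[a, b]) (f x * f x))%:E).
  rewrite poweR12_sqrt// lee_fin; apply: Rintegral_ge0 => x _.
  by rewrite -expr2 sqr_ge0.
rewrite /Rintegral fineK; last exact: integrable_fin_num.
rewrite [RHS]integral_mkcond; apply: eq_integral => x _.
rewrite patchE /= powR_mulrn// real_normK ?num_real// expr2.
case: ifPn => // /negP xab; rewrite f0 ?mulr0//; apply/negP => xab'.
by apply: xab; apply/mem_set; rewrite /= in_itv.
Qed.

Lemma L2norm_itv_le (R : realType) (f : R -> R) (a b C : R) : continuous f ->
  (forall x, ~~ (a <= x <= b) -> f x = 0) -> 0 <= C ->
  \int[leb R]_(x in `[a, b]) (f x * f x) <= C ^+ 2 -> (L2norm f <= C%:E)%E.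
Proof.
move=> cf f0 C0 fC; rewrite (L2norm_itv cf f0) lee_fin.
by rewrite -[leRHS]ger0_norm// -sqrtr_sqr ler_wsqrtr.
Qed.

Lemma L2norm_itv_sup (R : realType) (f : R -> R) (a b C : R) : a <= b ->
  continuous f -> (forall x, ~~ (a <= x <= b) -> f x = 0) -> 0 <= C ->
  (forall x, a <= x <= b -> `|f x| <= C) ->
  (L2norm f <= (C * Num.sqrt (b - a))%:E)%E.
Proof.
move=> ab cf f0 C0 fC; apply: (L2norm_itv_le cf f0).
  by rewrite mulr_ge0// sqrtr_ge0.
rewrite exprMn sqr_sqrtr ?subr_ge0//; apply: le_Rintegral_cst => //.
  by move=> x; apply: cvgM; exact: cf.
move=> x xab; rewrite -expr2 -real_normK ?num_real// lerXn2r ?nnegrE//.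
exact: fC.
Qed.

Lemma Lfun2_itv (R : realType) (f : R -> R) (a b : R) : continuous f ->
  (forall x, ~~ (a <= x <= b) -> f x = 0) -> f \in Lfun (leb R) 2%:E.
Proof.
move=> cf f0; rewrite inE/=; apply/andP; split; rewrite inE/=.
  exact: continuous_measurable_fun.
rewrite /finite_norm -[X in (X < _)%E]/(L2norm f) (L2norm_itv cf f0).
exact: ltry.
Qed.

(** The difference of two time slices is supported in [[a, b]] and bounded by [C |s - t|], so its
    norm is at most [C sqrt (b - a) |s - t|]. *)
Lemma in_CL2_lipschitz (R : realType) (T a b C : R) (v : R -> R -> R) :
  a <= b -> 0 <= C ->
  (forall t, 0 <= t <= T -> v t \in Lfun (leb R) 2%:E) ->
  (forall t, 0 <= t <= T -> continuous (v t)) ->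
  (forall s t x, 0 <= s <= T -> 0 <= t <= T -> ~~ (a <= x <= b) -> v s x = v t
    x) ->
  (forall s t x, 0 <= s <= T -> 0 <= t <= T -> a <= x <= b ->
    `|v s x - v t x| <= C * `|s - t|) ->
  in_CL2 T v.
Proof.
move=> ab C0 vL cv v0 vC t tT; split; first exact: vL.
pose D := C * Num.sqrt (b - a).
have D0 : 0 <= D by rewrite mulr_ge0// sqrtr_ge0.
apply: (@squeeze_cvge _ _ _ _ (cst 0%E) _ (fun s => (D * `|s - t|)%:E)).
- apply: (@filterS _ (within `[0, T]%classic (nbhs t)) _ (fun s =>
    0 <= s <= T)).
    move=> s sT; apply/andP; split; first exact: Lnorm_ge0.
    rewrite /D mulrAC; apply: L2norm_itv_sup => //.
    + by move=> x; apply: cvgB; [exact: cv|exact: cv].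
    + by move=> x xab; rewrite /= (v0 s t x)// subrr.
    + by rewrite mulr_ge0.
    + by move=> x xab; exact: vC.
  suff : \forall s \near t, s \in `[0, T] -> 0 <= s <= T by [].
  by near=> s; rewrite in_itv.
- exact: cvg_cst.
- have c : (D * `|s - t|) @[s --> within `[0, T]%classic (nbhs t)] --> 0.
    have ch : (D * `|s - t|) @[s --> t] --> D * `|t - t|.
      apply: cvgM; first exact: cvg_cst.
      by apply: cvg_norm; apply: cvgB; [exact: cvg_id|exact: cvg_cst].
    by apply: cvg_within_filter; rewrite subrr normr0 mulr0 in ch.
  by apply: cvg_EFin => //; exact: nearW.
Unshelve. all: by end_near. Qed.

Lemma lipschitz_of_derive (R : realType) (f : R -> R) (B : R) : smooth f ->
  (forall x, `|derive1 f x| <= B) -> forall x y, `|f x - f y| <= B * `|x - y|.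
Proof.
move=> sf fB x y.
have [c _ ->] := MVT_between y x (fun z => smooth_is_derive z sf).
by rewrite normrM ler_wpM2r.
Qed.

(** * The limit solution *)

Lemma compat_outgoing (R : realType) (g0 g1 : R -> R) :
  test_function g0 -> test_function g1 ->
  (forall t : R, 0 <= t -> g1 t + derive1 g0 t - g1 0 = 0) ->
  g1 0 = 0 /\ forall x, 0 <= x -> g1 x + derive1 g0 x = 0.
Proof.
move=> /test_function_bounds[B0 B00 h0] /test_function_bounds[B1 B10 h1] hc.
pose M := B0 + B1.
(* [M] lies outside both supports, so the compatibility condition at [M] reads [- g1 0 = 0]. *)
have M0 : 0 <= M by rewrite addr_ge0// ltW.
have [_ _ _ d0] := h0 M; have [_ _ e1 _] := h1 M.
have g10 : g1 0 = 0.
  have := hc M M0; rewrite d0 ?e1 ?ger0_norm//; rewrite /M; lra.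
by split=> // x x0; have := hc x x0; rewrite g10 subr0.
Qed.

(* A single continuous formula for both pieces, valid because [g1 0 = 0]. *)
Lemma piecewise_solutionE (R : realType) (g0 g1 : R -> R) (t x : R) :
  test_function g0 -> test_function g1 -> g1 0 = 0 ->
  (forall x, 0 <= x -> g1 x + derive1 g0 x = 0) -> 0 <= t ->
  piecewise_solution g0 g1 t x =
  g0 (Num.min x 0) + t * g1 (Num.min x 0) + (g0 (Num.max (x - t) 0) - g0 0).
Proof.
move=> [sg0 _] [sg1 _] g10 g01 t0.
have cg1 : continuous g1 by exact: is_derive_continuous (fun z =>
  smooth_is_derive z sg1).
(* Since [g1 = - g0'] on the half-line, the integrals in d'Alembert's formula are differences of
   values of [g0] and cancel the incoming wave. *)
have int a b : 0 <= a -> a <= b -> \int[leb R]_(s in `[a, b]) g1 s = g0 a - g0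
  b.
  move=> a0 ab.
  transitivity (\int[leb R]_(s in `[a, b]) (- derive1 g0 s)).
    apply: eq_Rintegral => s /set_mem; rewrite /= in_itv/= => /andP[as_ _].
    by apply/eqP; rewrite -addr_eq0 g01// (le_trans a0).
  have dN (s : R) : is_derive s (1 : R) (- g0) (- derive1 g0 s).
    exact: is_deriveN (smooth_is_derive s sg0).
  have cN : continuous (fun s => - derive1 g0 s).
    by move=> s; apply: cvgN; exact: smooth_derive_continuous.
  by rewrite (Rintegral_FTC2 ab cN dN) /= opprK addrC.
rewrite /piecewise_solution; have [x0|x0] := ltP x 0.
  rewrite (max_idPr _); last by lra.
  by rewrite subrr addr0.
rewrite g10 mulr0 addr0; have [xt|xt] := ltP x t.
  rewrite (max_idPr _); last by lra.
  rewrite int; [|lra..]; rewrite [t - x]addrC mulr0 addr0; lra.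
rewrite (max_idPl _); last by lra.
by rewrite int; lra.
Qed.

Lemma piecewise_solution_left (R : realType) (g0 g1 : R -> R) (t x : R) :
  x < 0 -> piecewise_solution g0 g1 t x = g0 x + t * g1 x.
Proof. by rewrite /piecewise_solution => ->. Qed.

Lemma piecewise_solution_right (R : realType) (g0 g1 : R -> R) (t x : R) :
  test_function g0 -> test_function g1 -> g1 0 = 0 ->
  (forall x, 0 <= x -> g1 x + derive1 g0 x = 0) -> 0 <= t -> 0 <= x ->
  piecewise_solution g0 g1 t x = g0 (Num.max (x - t) 0).
Proof.
move=> t0 t1 g10 g01 t_ge0 x0; rewrite piecewise_solutionE// (min_idPr x0) g10;
  lra.
Qed.

Lemma piecewise_solution_continuous (R : realType) (g0 g1 : R -> R) (t : R) :
  test_function g0 -> test_function g1 -> g1 0 = 0 ->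
  (forall x, 0 <= x -> g1 x + derive1 g0 x = 0) -> 0 <= t ->
  continuous (piecewise_solution g0 g1 t).
Proof.
move=> t0 t1 g10 g01 t_ge0.
have cg0 : continuous g0 := is_derive_continuous (fun z =>
  smooth_is_derive z t0.1).
have cg1 : continuous g1 := is_derive_continuous (fun z =>
  smooth_is_derive z t1.1).
rewrite (_ : piecewise_solution g0 g1 t = fun x =>
  g0 (Num.min x 0) + t * g1 (Num.min x 0) + (g0 (Num.max (x - t) 0) - g0 0));
    last first.
  by apply/funext => x; exact: piecewise_solutionE.
have cmin : continuous (fun x : R => Num.min x 0).
  move=> x; apply: (@continuous_min R R id (fun=> 0)); first exact: cvg_id.
  exact: cvg_cst.
have cmax : continuous (fun x : R => Num.max (x - t) 0).
  move=> x; apply: (@continuous_max R R (fun x => x - t) (fun=> 0)).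
    by apply: cvgB; [exact: cvg_id|exact: cvg_cst].
  exact: cvg_cst.
move=> x; apply: cvgD.
  apply: cvgD; first exact: (continuous_comp (cmin x) (cg0 _)).
  apply: cvgM; first exact: cvg_cst.
  exact: (continuous_comp (cmin x) (cg1 _)).
apply: cvgB; last exact: cvg_cst.
exact: (continuous_comp (cmax x) (cg0 _)).
Qed.

Lemma max0_lipschitz (R : realType) (p q : R) :
  `|Num.max p 0 - Num.max q 0| <= `|p - q|.
Proof.
have [p0|p0] := leP p 0; have [q0|q0] := leP q 0; rewrite ?subrr ?normr0//.
- by rewrite sub0r normrN gtr0_norm// ltr0_norm; lra.
- by rewrite subr0 gtr0_norm// gtr0_norm; lra.
Qed.

(** The constant depends on [u], hence on [eps]: it serves the continuity in time of each single
    solution, not the limit. *)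
Lemma strip_time_lipschitz (R : realType) (T a b : R) (u : R -> R -> R) :
  0 <= T -> Ck_strip T 1 u ->
  exists2 C : R, 0 <= C & forall s t x : R, 0 <= s <= T -> 0 <= t <= T ->
    a <= x <= b -> `|u s x - u t x| <= C * `|s - t|.
Proof.
move=> T0 cu.
have [C hC] := strip_continuous_bounded a b T0 (Ck_strip_continuous
  (Ck_strip_Dt cu)).
exists `|C| => //.
have le_case s t x : 0 <= s <= T -> 0 <= t <= T -> a <= x <= b -> t <= s ->
    `|u s x - u t x| <= `|C| * `|s - t|.
  move=> /andP[s0 sT] /andP[t0 tT] xab ts.
  have dI r : r \in `]t, s[ -> is_derive r (1 : R) (u ^~ x) (Dt T u r x).
    rewrite in_itv/= => /andP[tr rs]; apply: (Ck_strip_derive_time x cu).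
    by rewrite (le_lt_trans t0 tr) (lt_le_trans rs sT).
  have cI : {within `[t, s], continuous (u ^~ x)}.
    apply: (strip_continuous_time T0 (Ck_strip_continuous cu)) => r.
    rewrite /= in_itv/= => /andP[tr rs].
    by rewrite (le_trans t0 tr) (le_trans rs sT).
  have [c /[!in_itv]/= /andP[tc cs] ->] := MVT_segment ts dI cI.
  rewrite normrM ler_wpM2r// (le_trans _ (ler_norm C))// hC//.
  by rewrite (le_trans t0 tc) (le_trans cs sT).
move=> s t x sT tT xab; have [ts|/ltW st] := leP t s; first exact: le_case.
by rewrite distrC [X in _ <= _ * X]distrC; exact: le_case.
Qed.

(** The initial density is at most [2 B^2] because [H <= 1], and the layer has width [2 a]. *)
Lemma layer_energy_init (R : realType) (T a B : R) (H g0 g1 : R -> R)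
    (u : R -> R -> R) : 0 <= T -> 0 <= a -> continuous H ->
  (forall x, 0 <= H x <= 1) ->
  (forall x, `|g1 x| <= B) -> (forall x, `|derive1 g0 x| <= B) ->
  wave_solution T H g0 g1 u -> layer_energy T a H u 0 <= 4 * B ^+ 2 * a.
Proof.
move=> T0 a0 cH H01 g1B g0B [cu _ u0 u1].
have B0 : 0 <= B by exact: le_trans (normr_ge0 _) (g1B 0).
have TT : 0 <= (0 : R) <= T by rewrite lexx.
have sqB y : `|y| <= B -> y * y <= B ^+ 2.
  by move=> yB; rewrite -expr2 -real_normK ?num_real// lerXn2r ?nnegrE.
rewrite (_ : 4 * B ^+ 2 * a = 2 * B ^+ 2 * (a - - a)); last by ring.
apply: le_Rintegral_cst; first by lra.
  exact: (strip_continuous_slice (strip_continuous_energy cH cu) TT).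
move=> x _; rewrite u1 /Dx (_ : u 0 = g0); last exact/funext.
have h1 := sqB _ (g1B x); have h2 := sqB _ (g0B x).
have /andP[h3 h4] := H01 x; have h5 : 0 <= derive1 g0 x * derive1 g0 x
  by rewrite -expr2 sqr_ge0.
move: (g1 x * g1 x) (derive1 g0 x * derive1 g0 x) (H x) h1 h2 h3 h4 h5 =>
  p q h; nra.
Qed.

(** With [lam = sqrt a] and [lam = - sqrt a] both terms on the right are multiples of [a]; dividing
    by [sqrt a] leaves the claim. *)
Lemma layer_trace_bound (R : realType) (T a E d : R) : 0 < a -> 0 <= E ->
  (forall lam, lam * d <= E * a + lam ^+ 2 * T / 8) ->
  `|d| <= (E + T / 8) * Num.sqrt a.
Proof.
move=> a0 E0 h; have r0 : 0 < Num.sqrt a by rewrite sqrtr_gt0.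
have ra : Num.sqrt a ^+ 2 = a by rewrite sqr_sqrtr// ltW.
have := h (Num.sqrt a); have := h (- Num.sqrt a).
rewrite sqrrN ra -[in E * a]ra => h1 h2.
rewrite -(ler_pM2l r0) -[X in X * `|d|]gtr0_norm// -normrM ler_norml.
by apply/andP; split; nra.
Qed.

(** * Convergence *)

Lemma Rintegral_itv_split (R : realType) (f : R -> R) (a b c : R) :
  a <= b -> b <= c -> continuous f ->
  \int[leb R]_(x in `[a, c]) f x =
  \int[leb R]_(x in `[a, b]) f x + \int[leb R]_(x in `[b, c]) f x.
Proof.
move=> ab bc cf; have iac := continuous_integrable_itv a c cf.
have ibc := continuous_integrable_itv b c cf.
have E := @Rintegral_itvB _ f (BLeft a) (BRight c) b iac.
rewrite !bnd_simp in E; have {}E := E ab bc.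
have : \int[leb R]_(x in `]b, c]) f x = \int[leb R]_(x in `[b, c]) f x.
  apply: Rintegral_itv_obnd_cbnd; apply: integrableS ibc => //.
  by move=> x /=; rewrite !in_itv/= => /andP[/ltW-> ->].
by rewrite -E => <-; rewrite addrC subrK.
Qed.

Lemma layer_trace_error (R : realType) (T a B : R) (H g0 g1 : R -> R)
    (u : R -> R -> R) (t : R) : 0 < a -> continuous H ->
  (forall x, 0 <= H x <= 1) -> H (- a) = 0 -> H a = 1 ->
  (forall x, `|g1 x| <= B) -> (forall x, `|derive1 g0 x| <= B) ->
  wave_solution T H g0 g1 u ->
  (forall s, 0 <= s <= T -> Dt T u s a + Dx u s a = 0) -> 0 <= t <= T ->
  `|u t a - g0 a| <= (4 * B ^+ 2 + T / 8) * Num.sqrt a.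
Proof.
move=> a0 cH H01 Ha0 Ha1 g1B g0B wu ua tT; have [cu _ u0 _] := wu.
have /andP[t0 tT'] := tT; have T0 := le_trans t0 tT'.
have H0 x : 0 <= H x by have /andP[] := H01 x.
apply: layer_trace_bound => //; first by rewrite mulr_ge0// sqr_ge0.
move=> lam; have := layer_trace lam (ltW a0) cH H0 Ha0 Ha1 wu ua tT.
have := layer_energy_init T0 (ltW a0) cH H01 g1B g0B wu.
have := @layer_energy_ge0 R T a H u t H0; rewrite u0.
have : lam ^+ 2 * t <= lam ^+ 2 * T by rewrite ler_wpM2l// sqr_ge0.
move: (layer_energy T a H u 0) (layer_energy T a H u t) (lam ^+ 2 * t) (lam ^+
  2 * T).
by move: (lam * (u t a - g0 a)) (4 * B ^+ 2 * a) => d e J0 J p q; lra.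
Qed.

(** Coefficient of [a] in the bound on the squared distance. The summands come from [u - g0] in the
    layer, from [g0] minus the limit in the layer, and from the segment [[a, a + T]]. *)
Definition error_cst (R : realType) (T B : R) : R :=
  8 * (T + 1) ^+ 2 * T * B ^+ 2 + 4 * (B * (2 + T)) ^+ 2 +
  (4 * B ^+ 2 + T / 8 + B) ^+ 2 * T.

Lemma wave_piecewise_L2 (R : realType) (T a B : R) (H g0 g1 : R -> R)
    (u : R -> R -> R) (t : R) : 0 < a <= 1 -> continuous H ->
  (forall x, 0 <= H x <= 1) -> (forall x, x <= - a -> H x = 0) ->
  (forall x, a <= x -> H x = 1) ->
  test_function g0 -> test_function g1 -> g1 0 = 0 ->
  (forall x, 0 <= x -> g1 x + derive1 g0 x = 0) ->
  (forall x, `|g0 x| <= B) -> (forall x, `|derive1 g0 x| <= B) ->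
  (forall x, `|g1 x| <= B) ->
  wave_solution T H g0 g1 u -> 0 <= t <= T ->
  (L2norm (u t \- piecewise_solution g0 g1 t)%R <=
   ((error_cst T B + 1) * Num.sqrt a)%:E)%E.
Proof.
move=> /andP[a0 a1] cH H01 H0 H1 tg0 tg1 g10 g01 g0B dg0B g1B wu tT.
have [cu _ u0 _] := wu; have /andP[t0 tT'] := tT; have T0 := le_trans t0 tT'.
have H_ge0 x : 0 <= H x by have /andP[] := H01 x.
have Hl : H (- a) = 0 by exact: H0.
have Hr : H a = 1 by exact: H1.
have g01a x : a <= x -> g1 x + derive1 g0 x = 0.
  by move=> ax; apply: g01; rewrite (le_trans _ ax)// ltW.
have out := wave_solution_outgoing wu H1 g01a.
have outa s : 0 <= s <= T -> Dt T u s a + Dx u s a = 0.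
  by move=> sT; exact: out.
have B0 : 0 <= B by exact: le_trans (normr_ge0 _) (g1B 0).
have cg0 : continuous g0 := is_derive_continuous (fun z =>
  smooth_is_derive z tg0.1).
have cut := strip_continuous_slice (Ck_strip_continuous cu) tT.
have cpw : continuous (piecewise_solution g0 g1 t).
  exact: piecewise_solution_continuous.
set v := piecewise_solution g0 g1 t.
have cD : continuous (u t \- v) by move=> x; apply: cvgB;
  [exact: cut|exact: cpw].
have cDD : continuous (fun x => (u t \- v) x * (u t \- v) x).
  by move=> x; apply: cvgM; exact: cD.
have r0 : 0 < Num.sqrt a by rewrite sqrtr_gt0.
have ra : Num.sqrt a ^+ 2 = a by rewrite sqr_sqrtr// ltW.
have r1 : Num.sqrt a <= 1 by rewrite -[leRHS]sqrtr1 ler_wsqrtr.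
have vr x : 0 <= x -> v x = g0 (Num.max (x - t) 0).
  by move=> x0; exact: piecewise_solution_right.
have far x : a <= x - t -> u t x = v x.
  move=> ax; have ttT : 0 <= (0 : R) <= t by rewrite lexx.
  have := wave_solution_right (x := x) wu H1 g01a ttT tT'.
  rewrite subr0 => /(_ ax) ->; rewrite u0 vr; last by lra.
  by rewrite (max_idPl _)//; lra.
set K1 := 4 * B ^+ 2 + T / 8 + B.
have K1_ge0 : 0 <= K1.
  by rewrite /K1 addr_ge0// addr_ge0 ?divr_ge0// mulr_ge0// sqr_ge0.
have right x : a <= x <= a + T -> `|(u t \- v) x| <= K1 * Num.sqrt a.
  move=> /andP[ax xaT]; have [axt|xta] := leP a (x - t).
    by rewrite /= far// subrr normr0 mulr_ge0// ltW.
  (* The time at which the line [x - t = const] through the point crosses [x = a]. *)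
  have sT : 0 <= t - (x - a) <= t by apply/andP; split; lra.
  have := wave_solution_right (x := x) wu H1 g01a sT tT'.
  rewrite (_ : x - (t - (t - (x - a))) = a); last by lra.
  move=> /(_ (lexx _)) E.
  have sT' : 0 <= t - (x - a) <= T by have /andP[-> /le_trans->] := sT.
  have h1 := layer_trace_error a0 cH H01 Hl Hr g1B dg0B wu outa sT'.
  have h2 := lipschitz_of_derive tg0.1 dg0B a (Num.max (x - t) 0).
  have h3 : `|a - Num.max (x - t) 0| <= a.
    by have [?|?] := leP (x - t) 0; rewrite ger0_norm; lra.
  rewrite /= E vr; last by lra.
  rewrite -(subrKA (g0 a)) (le_trans (ler_normD _ _))//.
  rewrite /K1 mulrDl lerD// (le_trans h2)// ler_wpM2l// (le_trans h3)//.
  (* Here [a <= 1] enters, through [a <= sqrt a]. *)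
  by rewrite -[X in X <= _]ra expr2 ger_pMl.
(* The squared distance is at most [error_cst T B * a], and [k <= (k + 1)^2] avoids a square root of
   the constant. *)
pose C := error_cst T B + 1.
have K_ge0 : 0 <= error_cst T B.
  rewrite /error_cst !addr_ge0 ?mulr_ge0 ?sqr_ge0//; lra.
apply: (@L2norm_itv_le _ _ (- a) (a + T)) => //.
- move=> x; rewrite negb_and -!ltNge => /orP[xa|xa].
    rewrite /= (wave_solution_left wu (b := - a) _ tT xa); last first.
      by move=> y /ltW; exact: H0.
    by rewrite /v piecewise_solution_left ?subrr//; lra.
  by rewrite /= far ?subrr//; lra.
- by rewrite mulr_ge0 ?sqrtr_ge0// addr_ge0.
rewrite (@Rintegral_itv_split _ _ (- a) a (a + T)) //; [|by lra..].
have I2 : \int[leb R]_(x in `[a, a + T]) ((u t \- v) x * (u t \- v) x) <=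
    (K1 ^+ 2 * a) * (a + T - a).
  apply: le_Rintegral_cst => //; first by lra.
  move=> x xaT; rewrite -expr2 -real_normK ?num_real//.
  rewrite -[X in _ <= _ * X]ra -exprMn lerXn2r ?nnegrE//; last exact: right.
  by rewrite mulr_ge0// ltW.
have cw : continuous (fun x => (u t x - g0 x) * (u t x - g0 x)).
  by move=> x; apply: cvgM; apply: cvgB;
    [exact: cut|exact: cg0|exact: cut|exact: cg0].
have cw2 : continuous (fun x => 2 * ((u t x - g0 x) * (u t x - g0 x))).
  by move=> x; apply: cvgM; [exact: cvg_cst|exact: cw].
set m := 2 * (B * (2 + T)) ^+ 2.
have cw3 : continuous (fun x => 2 * ((u t x - g0 x) * (u t x - g0 x)) + m).
  by move=> x; apply: cvgD; [exact: cw2|exact: cvg_cst].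
(* A bound independent of [a] is enough, the layer having width [2 a]. On the left the difference is
   [t g1]; on the right it is a difference of two values of [g0]. *)
have vB x : `|g0 x - v x| <= B * (2 + T).
  have tB : t * B <= T * B by exact: ler_wpM2r.
  have [x0|x0] := ltP x 0.
    rewrite /v piecewise_solution_left// opprD addNKr normrN normrM ger0_norm//.
    have : t * `|g1 x| <= t * B by exact: ler_wpM2l.
    by move: (t * `|g1 x|) => ?; nra.
  rewrite vr// (le_trans (ler_normB _ _))//.
  by have := g0B x; have := g0B (Num.max (x - t) 0); nra.
have I1 : \int[leb R]_(x in `[- a, a]) ((u t \- v) x * (u t \- v) x) <=
    2 * ((T + 1) ^+ 2 * T * (4 * B ^+ 2 * a)) + m * (a - - a).
  apply: (@le_trans _ _ (\int[leb R]_(x in `[- a, a])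
     (2 * ((u t x - g0 x) * (u t x - g0 x)) + m))).
    apply: le_Rintegral => //; [exact: continuous_integrable_itv..|].
    move=> x _ /=.
    have : (g0 x - v x) ^+ 2 <= (B * (2 + T)) ^+ 2.
      rewrite -real_normK ?num_real// lerXn2r ?nnegrE// mulr_ge0//; lra.
    rewrite /m; move: (u t x) (g0 x) (v x) ((B * (2 + T)) ^+ 2) => p q r M h.
    (* This is [(p - r)^2 <= 2 (p - q)^2 + 2 (q - r)^2]. *)
    by have := sqr_ge0 (p - q - (q - r)); nra.
  rewrite RintegralD//; [|exact: continuous_integrable_itv|exact:
    integrable_cst_itv].
  apply: lerD; last first.
    by apply: le_Rintegral_cst; [lra|move=> x; exact: cvg_cst|].
  rewrite RintegralZl//; last exact: continuous_integrable_itv.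
  rewrite ler_wpM2l//.
  apply: (le_trans (layer_displacement (ltW a0) cH H_ge0 Hl Hr wu outa cg0 tT)).
  apply: ler_wpM2l; first by rewrite mulr_ge0 ?sqr_ge0.
  exact: (layer_energy_init T0 (ltW a0) cH H01 g1B dg0B wu).
apply: (le_trans (lerD I1 I2)); rewrite exprMn ra.
rewrite [leLHS](_ : _ = error_cst T B * a); last first.
  by rewrite /error_cst -/K1 /m; ring.
rewrite ler_wpM2r//; first exact: ltW.
by move: (error_cst T B) K_ge0 => k k0; nra.
Qed.

Lemma regularised_heaviside (R : realType) (phi omega : R -> R) (K eps : R) :
  mollifier phi -> (forall x, K <= `|x| -> phi x = 0) -> 0 <= K ->
  0 < omega eps -> let H := regularised (@heaviside R) phi omega eps in
  [/\ continuous H, forall x, 0 <= H x <= 1,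
      forall x, x <= - (K * omega eps) -> H x = 0 &
      forall x, K * omega eps <= x -> H x = 1].
Proof.
move=> mphi phiK K0 w0 H.
have HE x : H x = mollifier_cdf phi (x / omega eps).
  exact: conv_heaviside_rescale mphi phiK K0 w0.
split.
- have cF : continuous (mollifier_cdf phi).
    exact: (is_derive_continuous (fun z => derive_mollifier_cdf z mphi)).
  have cq : continuous (fun x : R => x / omega eps).
    by move=> x; apply: cvgM; [exact: cvg_id|exact: cvg_cst].
  rewrite (_ : H = mollifier_cdf phi \o (fun x => x / omega eps));
    last exact/funext.
  by move=> x; exact: (continuous_comp (cq x) (cF _)).
- by move=> x; rewrite HE; exact: (mollifier_cdf_itv _ mphi phiK).
- by move=> x xK; rewrite HE (mollifier_cdf0 phiK)// ler_pdivrMr// mulNr.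
- by move=> x xK; rewrite HE (mollifier_cdf1 mphi phiK)// ler_pdivlMr.
Qed.

Lemma Ck_stripW (R : realType) (T : R) (k : nat) (u : R -> R -> R) :
  Ck_strip T k.+1 u -> Ck_strip T k u.
Proof.
elim: k u => [u [cu _]|k IH u [cu [du cut cux]]]; first by split.
exact: (conj cu (And3 du (IH _ cut) (IH _ cux))).
Qed.

(** The exact formulas on both sides of the layer confine the support of [u t] to one segment for
    all [t]; there [u] is Lipschitz in time. *)
Lemma wave_solution_CL2 (R : realType) (T a B : R) (H g0 g1 : R -> R)
    (u : R -> R -> R) : 0 <= T -> 0 <= a -> 0 <= B ->
  (forall x, x <= - a -> H x = 0) -> (forall x, a <= x -> H x = 1) ->
  (forall x, B <= `|x| -> g0 x = 0) -> (forall x, B <= `|x| -> g1 x = 0) ->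
  (forall x, 0 <= x -> g1 x + derive1 g0 x = 0) ->
  wave_solution T H g0 g1 u ->
  (forall t, 0 <= t <= T -> u t \in Lfun (leb R) 2%:E) -> in_CL2 T u.
Proof.
move=> T0 a0 B0 H0 H1 g0B g1B g01 wu uL; have [cu _ u0 _] := wu.
have [C C0 uC] := @strip_time_lipschitz _ T (- (a + B)) (a + B + T) u T0
  (Ck_stripW cu).
have zero t x : 0 <= t <= T -> ~~ (- (a + B) <= x <= a + B + T) -> u t x = 0.
  move=> tT; have /andP[t0 tT'] := tT.
  rewrite negb_and -!ltNge => /orP[xa|xa].
    rewrite (wave_solution_left wu (b := - a) _ tT); last 2 first.
    - by move=> y /ltW; exact: H0.
    - by lra.
    have xB : B <= `|x| by rewrite -normrN (le_trans _ (ler_norm _))//; lra.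
    by rewrite g0B// g1B// mulr0 addr0.
  have ttT : 0 <= (0 : R) <= t by rewrite lexx.
  have g01a y : a <= y -> g1 y + derive1 g0 y = 0.
    by move=> ay; apply: g01; exact: le_trans a0 ay.
  rewrite (wave_solution_right wu H1 g01a ttT tT'); last by lra.
  by rewrite u0 g0B// (le_trans _ (ler_norm _))//; lra.
apply: (@in_CL2_lipschitz _ T (- (a + B)) (a + B + T) C) => //; first by lra.
- by move=> t tT; exact: strip_continuous_slice (Ck_strip_continuous cu) tT.
- by move=> s t x sT tT xab; rewrite !zero.
Qed.

Lemma piecewise_solution_CL2 (R : realType) (T B : R) (g0 g1 : R -> R) :
  0 <= T -> 0 < B -> test_function g0 -> test_function g1 ->
  (forall x, B <= `|x| -> g0 x = 0) -> (forall x, B <= `|x| -> g1 x = 0) ->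
  (forall x, `|derive1 g0 x| <= B) -> (forall x, `|g1 x| <= B) ->
  g1 0 = 0 -> (forall x, 0 <= x -> g1 x + derive1 g0 x = 0) ->
  in_CL2 T (piecewise_solution g0 g1).
Proof.
move=> T0 B0 tg0 tg1 g0S g1S dg0B g1B g10 g01.
have cpw t : 0 <= t <= T -> continuous (piecewise_solution g0 g1 t).
  by move=> /andP[t0 _]; exact: piecewise_solution_continuous.
have zero t x : 0 <= t <= T -> ~~ (- B <= x <= B + T) ->
    piecewise_solution g0 g1 t x = 0.
  move=> /andP[t0 tT]; rewrite negb_and -!ltNge => /orP[xa|xa].
    have xB : B <= `|x| by rewrite -normrN (le_trans _ (ler_norm _))//; lra.
    by rewrite piecewise_solution_left ?g0S ?g1S ?mulr0 ?addr0//; lra.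
  rewrite piecewise_solution_right//; last by lra.
  by rewrite g0S// (le_trans _ (ler_norm _))// le_max; apply/orP; left; lra.
(* One [B] bounds [g1] in the term linear in [t], the other bounds [g0'] in the travelling wave. *)
apply: (@in_CL2_lipschitz _ T (- B) (B + T) (2 * B)) => //.
- by lra.
- by lra.
- by move=> t tT; apply: (@Lfun2_itv _ _ (- B) (B + T)); [exact: cpw|move=> x;
    exact: zero].
- by move=> s t x sT tT xab; rewrite !zero.
move=> s t x /andP[s0 _] /andP[t0 _] _; rewrite !piecewise_solutionE//.
set p := Num.min x 0; rewrite (_ : _ - _ = (s - t) * g1 p +
  (g0 (Num.max (x - s) 0) - g0 (Num.max (x - t) 0))); last by ring.
have h1 := lipschitz_of_derive tg0.1 dg0B (Num.max (x - s) 0) (Num.max (x - t)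
  0).
have h2 := max0_lipschitz (x - s) (x - t).
have h3 : `|x - s - (x - t)| = `|s - t|.
  by rewrite distrC; congr (`|_|); ring.
rewrite (_ : 2 * B * _ = B * `|s - t| + B * `|s - t|); last by ring.
rewrite (le_trans (ler_normD _ _))// lerD//.
  by rewrite normrM mulrC ler_wpM2r.
by apply: (le_trans h1); apply: (ler_wpM2l (ltW B0)); rewrite -h3.
Qed.

(** The lower bound uses that [[0, T]] contains [0]: the supremum of the empty set would be
    [-oo]. *)
Lemma CL2_dist_le (R : realType) (T C : R) (v w : R -> R -> R) : 0 <= T ->
  (forall t, 0 <= t <= T -> (L2norm (v t \- w t)%R <= C%:E)%E) ->
  (0 <= CL2_dist T v w <= C%:E)%E.
Proof.
move=> T0 vwC; apply/andP; split.
  apply: (@le_trans _ _ (L2norm (v 0 \- w 0)%R)); first exact: Lnorm_ge0.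
  by apply: ereal_sup_ubound; exists 0 => //=; rewrite in_itv/= lexx.
apply: ge_ereal_sup => _ [t + <-]; rewrite /= in_itv/=; exact: vwC.
Qed.

Theorem theorem4p1 (R : realType) (T : R) (g0 g1 : R -> R) (phi omega : R -> R)
    (u : R -> R -> R -> R) (hT : 0 < T)
    (hg0 : test_function g0) (hg1 : test_function g1)
    (hcompat : forall t : R, 0 <= t -> g1 t + derive1 g0 t - g1 0 = 0)
    (hphi : mollifier phi) (homega : positive_scale omega)
    (hu : very_weak_solution T (@heaviside R) phi omega g0 g1 u) :
  cvg_CL2 T u (piecewise_solution g0 g1).
Proof.
have [g10 g01] := compat_outgoing hg0 hg1 hcompat.
have [B0 B00 b0] := test_function_bounds hg0.
have [B1 B10 b1] := test_function_bounds hg1.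
have [tphi _ _] := hphi; have [K K0 bK] := test_function_bounds tphi.
have phiK x : K <= `|x| -> phi x = 0 by have [_ _] := bK x.
pose B := B0 + B1; have Bpos : 0 < B by rewrite addr_gt0.
have g0B x : `|g0 x| <= B by have [h _ _ _] := b0 x;
  rewrite (le_trans h)// lerDl ltW.
have dg0B x : `|derive1 g0 x| <= B.
  by have [_ h _ _] := b0 x; rewrite (le_trans h)// lerDl ltW.
have g1B x : `|g1 x| <= B by have [h _ _ _] := b1 x;
  rewrite (le_trans h)// lerDr ltW.
have g0S x : B <= `|x| -> g0 x = 0.
  by have [_ _ h _] := b0 x => Bx; apply: h;
    rewrite (le_trans _ Bx)// lerDl ltW.
have g1S x : B <= `|x| -> g1 x = 0.
  by have [_ _ h _] := b1 x => Bx; apply: h;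
    rewrite (le_trans _ Bx)// lerDr ltW.
have [wu [N [c [_ umod]]]] := hu; have [w0 wlim] := homega.
have T0 := ltW hT.
split.
- move=> eps epsI; have we := w0 _ epsI.
  have [_ _ H0 H1] := regularised_heaviside hphi phiK (ltW K0) we.
  apply: (wave_solution_CL2 T0 _ (ltW Bpos) H0 H1 g0S g1S g01 (wu _ epsI)).
    by rewrite mulr_ge0 ?ltW.
  by move=> t tT; have [] := umod eps t epsI tT.
- exact: (@piecewise_solution_CL2 _ T B).
pose D := error_cst T B + 1.
have aK : (K * omega eps) @[eps --> 0^'+] --> 0.
  rewrite -[X in _ --> X](mulr0 K); apply: cvgM => //; exact: cvg_cst.
have bnd : \forall eps \near 0^'+, (0 <= CL2_dist T (u eps) (piecewise_solution
  g0 g1)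
    <= (D * Num.sqrt (K * omega eps))%:E)%E.
  (* The distance estimate is stated for layers of half-width at most 1. *)
  have a1 : \forall eps \near 0^'+, K * omega eps < 1.
    by apply: (cvgr_lt _ aK).
  near=> eps.
  have epsI : 0 < eps <= 1.
    apply/andP; split; first by near: eps; exact: nbhs_right_gt.
    by near: eps; exact: nbhs_right_le.
  have we := w0 _ epsI.
  have [cH H01 H0 H1] := regularised_heaviside hphi phiK (ltW K0) we.
  apply: CL2_dist_le => // t tT.
  apply: (wave_piecewise_L2 _ cH H01 H0 H1 hg0 hg1 g10 g01 g0B dg0B g1B (wu _
    epsI) tT).
  rewrite mulr_gt0//=; apply: ltW; near: eps; exact: a1.
apply: (squeeze_cvge bnd); first exact: cvg_cst.
apply: cvg_EFin; first exact: nearW.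
rewrite -[X in _ --> X](mulr0 D); apply: cvgM; first exact: cvg_cst.
rewrite -[X in _ --> X]sqrtr0.
by apply: (continuous_cvg _ _ aK); exact: sqrt_continuous.
Unshelve. all: by end_near. Qed.
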